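(* Let $\mu=\mathcal N(0,\Sigma_\mu)$ and $\nu=\mathcal N(0,\Sigma_\nu)$ be Gaussian measures on $\mathbb R^n$ with $\Sigma_\mu,\Sigma_\nu\succ0$, and let $(X_t,Y_t)$ evolve according to the $L^2$-OCD dynamics $$\dot X_t=Y_t-\mathbb E_{p_t}[Y_t\mid X_t],\qquad \dot Y_t=X_t-\mathbb E_{p_t}[X_t\mid Y_t],$$ where $p_t$ is the joint law of $(X_t,Y_t)$, initialized with independent samples $(X_0,Y_0)\sim\mu\otimes\nu$. Let $J_t=\mathbb E[X_t\otimes Y_t]$. If the covariances commute, i.e. $[\Sigma_\mu,\Sigma_\nu]=\Sigma_\mu\Sigma_\nu-\Sigma_\nu\Sigma_\mu=0$, then the $L^2$-OCD converges to the optimal transport correlation, namely $$J_t\longrightarrow J_\infty=\Sigma_\mu^{1/2}\big(\Sigma_\mu^{1/2}\Sigma_\nu\Sigma_\mu^{1/2}\big)^{1/2}\Sigma_\mu^{-1/2}=J_{\mathrm{OT}}\qquad\text{as }t\to\infty .$$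
   Context: $A\otimes B=AB^\top$ for $A,B\in\mathbb R^n$. $J_{\mathrm{OT}}$ is the cross-correlation $\mathbb E[X\otimes Y]$ of the optimal coupling $(X,Y)$ of $\mu$ and $\nu$ for the cost $\tfrac12\|x-y\|_2^2$, i.e. the minimizer of $\mathbb E\|X-Y\|_2^2/2$ over couplings of $\mu$ and $\nu$. Setting: in this Gaussian setting, the joint law $p_t$ of the $L^2$-OCD dynamics is taken to be (centered) Gaussian with marginals $\mu,\nu$, so that $\mathbb E_{p_t}[Y_t\mid X_t]=J_t^\top\Sigma_\mu^{-1}X_t$ and $\mathbb E_{p_t}[X_t\mid Y_t]=J_t\Sigma_\nu^{-1}Y_t$, and $J_t$ satisfies the matrix Riccati equation $$\partial_tJ_t=\Sigma_\mu+\Sigma_\nu-J_t^\top\Sigma_\mu^{-1}J_t-J_t\Sigma_\nu^{-1}J_t^\top,\qquad J_0=0 .$$ *)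

(* Defs.v *)
From HB Require Import structures.
From mathcomp Require Import all_boot all_order all_algebra.
From mathcomp Require Import all_classical all_reals all_analysis.

Set Implicit Arguments.
Unset Strict Implicit.
Unset Printing Implicit Defensive.

Import Order.TTheory GRing.Theory Num.Theory.
Import numFieldNormedType.Exports.

Local Open Scope classical_set_scope.
Local Open Scope ring_scope.

(* R^n is 'cV[R]_n, with the sigma-algebra generated by the coordinates, i.e.
   the Borel sigma-algebra of R^n. *)
Definition measure_cV_display : measure_display.
Proof. exact. Qed.

Section measurable_cV.
Context {R : realType} (n : nat).

Let coord : 'I_n -> 'cV[R]_n -> R := fun i x => x i 0.

Let cV_set0 : g_sigma_preimage coord set0.
Proof. exact: sigma_algebra0. Qed.

Let cV_setC A : g_sigma_preimage coord A -> g_sigma_preimage coord (~` A).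
Proof. exact: sigma_algebraC. Qed.

Let cV_bigcup (F : (set 'cV[R]_n)^nat) :
  (forall i, g_sigma_preimage coord (F i)) ->
  g_sigma_preimage coord (\bigcup_i (F i)).
Proof. exact: sigma_algebra_bigcup. Qed.

HB.instance Definition _ := @isMeasurable.Build measure_cV_display
  'cV[R]_n (g_sigma_preimage coord) cV_set0 cV_setC cV_bigcup.

End measurable_cV.

Section symmetric_matrices.
Context {R : realType} {n : nat}.
Implicit Types S B : 'M[R]_n.

Definition psdmx S := S^T = S /\ forall x : 'cV[R]_n, 0 <= (x^T *m S *m x) 0 0.

Definition pdmx S :=
  S^T = S /\ forall x : 'cV[R]_n, x != 0 -> 0 < (x^T *m S *m x) 0 0.

(* The principal square root S^{1/2} of a positive semidefinite S, i.e. its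
   unique positive semidefinite square root; 0 if there is none. *)
Definition sqrtmx S : 'M[R]_n := xget 0 [set B | psdmx B /\ B *m B = S].

End symmetric_matrices.

Section gaussian_laws.
Context {R : realType} {n : nat}.

(* N(0, I_n): independent coordinates, each with law N(0, 1). *)
Definition std_gaussian (gamma : set 'cV[R]_n -> \bar R) :=
  forall A : 'I_n -> set R, (forall i, measurable (A i)) ->
  gamma [set z | forall i, A i (z i 0)] =
  (\prod_(i < n) fine (normal_prob 0 1 (A i)))%:E.

(* N(0, S) for S positive semidefinite, possibly singular: the law of
   S^{1/2} Z with Z ~ N(0, I_n). *)
Definition centered_gaussian (S : 'M[R]_n) (m : set 'cV[R]_n -> \bar R) :=
  exists gamma : probability 'cV[R]_n R, std_gaussian gamma /\
  forall A, measurable A -> m A = pushforward gamma (mulmx (sqrtmx S)) A.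

End gaussian_laws.

Section expectations.
Context {R : realType} d {Omega : measurableType d}
  (P : probability Omega R).

(* E[X (x) Y] = E[X Y^T] *)
Definition cross_corr n (X Y : Omega -> 'cV[R]_n) : 'M[R]_n :=
  \matrix_(i, j) (\int[P]_w (X w *m (Y w)^T) i j).

(* G is a sub-sigma-algebra, given by its set of events. *)
Definition is_cond_exp (G : set (set Omega)) (f g : Omega -> R) :=
  [/\ forall B, measurable B -> G (g @^-1` B),
      P.-integrable setT (EFin \o g) &
      forall A, G A ->
        (\int[P]_(w in A) (g w)%:E = \int[P]_(w in A) (f w)%:E)%E].

(* E is a version of E[Y | X]. *)
Definition is_cond_expV n (Y X E : Omega -> 'cV[R]_n) :=
  forall i : 'I_n,
    is_cond_exp (preimage_set_system setT X measurable)
      (fun w => Y w i 0) (fun w => E w i 0).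

End expectations.

(* Derivative at t >= 0 of a curve defined on [0, +oo[; one-sided at t = 0. *)
Definition is_derive_ge0 {R : realType} {n : nat}
    (f : R -> 'cV[R]_n) (t : R) (v : 'cV[R]_n) :=
  h^-1 *: (f (t + h) - f t) @[h --> within [set h | 0 <= t + h] 0^'] --> v.

Section L2_OCD.
Context {R : realType} d {Omega : measurableType d}
  (P : probability Omega R) {n : nat}.
Implicit Types (mu nu : probability 'cV[R]_n R).
Implicit Types (X Y : R -> {RV P >-> 'cV[R]_n}).
Implicit Types (EYX EXY : R -> Omega -> 'cV[R]_n).

(* Only the values at times t >= 0 matter. EYX t and EXY t are versions of
   E[Y_t | X_t] and E[X_t | Y_t]; the equations hold along almost every path. *)
Definition L2_OCD X Y EYX EXY :=
  [/\ forall t, 0 <= t -> is_cond_expV P (Y t) (X t) (EYX t),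
      forall t, 0 <= t -> is_cond_expV P (X t) (Y t) (EXY t) &
      {ae P, forall w, forall t, 0 <= t ->
        is_derive_ge0 (fun s => X s w) t (Y t w - EYX t w) /\
        is_derive_ge0 (fun s => Y s w) t (X t w - EXY t w)}].

(* (X_0, Y_0) ~ mu (x) nu *)
Definition independent_start mu nu X Y :=
  forall A, measurable A ->
    pushforward P (fun w => (X 0 w, Y 0 w)) A = (mu \x nu)%E A.

(* p_t is centered Gaussian on R^n x R^n = R^(n + n), with marginals mu, nu. *)
Definition gaussian_joint_laws mu nu X Y :=
  forall t, 0 <= t ->
  [/\ exists C : 'M[R]_(n + n), psdmx C /\
        centered_gaussian C (pushforward P (fun w => col_mx (X t w) (Y t w))),
      forall A, measurable A -> distribution P (X t) A = mu A &
      forall A, measurable A -> distribution P (Y t) A = nu A].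

(* A conditional expectation is determined only almost surely at each fixed t,
   so an equation holding at all times depends on the chosen versions; these
   are the linear ones given by Gaussian conditioning. *)
Definition gaussian_versions (Smu Snu : 'M[R]_n) X Y EYX EXY :=
  {ae P, forall w, forall t, 0 <= t ->
    EYX t w = (cross_corr P (X t) (Y t))^T *m invmx Smu *m X t w /\
    EXY t w = cross_corr P (X t) (Y t) *m invmx Snu *m Y t w}.

End L2_OCD.

Section optimal_transport.
Context {R : realType} {n : nat}.
Implicit Types (mu nu : probability 'cV[R]_n R).
Implicit Types pi : probability ('cV[R]_n * 'cV[R]_n)%type R.

Definition coupling mu nu pi :=
  (forall A, measurable A -> pi (A `*` setT) = mu A) /\
  (forall B, measurable B -> pi (setT `*` B) = nu B).

Definition transport_cost pi : \bar R :=
  (\int[pi]_z (2^-1 * \sum_(i < n) (z.1 i 0 - z.2 i 0) ^+ 2)%:E)%E.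

Definition optimal_coupling mu nu pi :=
  coupling mu nu pi /\
  forall pi', coupling mu nu pi' -> (transport_cost pi <= transport_cost pi')%E.

(* J = J_OT: an optimal coupling exists, and J is its cross-correlation
   (whichever optimal coupling is taken). *)
Definition is_OT_corr mu nu (J : 'M[R]_n) :=
  (exists pi, optimal_coupling mu nu pi) /\
  forall pi, optimal_coupling mu nu pi -> cross_corr pi fst snd = J.

End optimal_transport.

(* Main.v *)
Require Import Defs.
From HB Require Import structures.
From mathcomp Require Import all_boot all_order all_algebra.
From mathcomp Require complex.
From mathcomp Require Import all_classical all_reals all_analysis.
From mathcomp Require Import measurable_realfun ring lra.

(** The two covariances [A = Smu] and [B = Snu] commute, so they are
    diagonalized by a common basis, with positive eigenvalues [a i] and [b i].
    In that basis the matrix Riccati equation decouples into the scalar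
    equations [d' = a + b - d^2 / a - d^2 / b], [d 0 = 0], solved by
    [sqrt (a b) tanh ((a + b) t / sqrt (a b))], which tends to [sqrt (a b)].
    The diagonal matrix of the [sqrt (a i * b i)] is [Jinf], because all the
    square roots in its definition are diagonal in the same basis
    ([commuting_sqrtmx_formula]). The curve so obtained,
    [commuting_solution], solves the matrix equation; as the Riccati vector
    field is Lipschitz on bounded sets, a bounded solution starting from [0]
    has to be this one ([riccati_unique]).

    That [J t = E[X_t Y_t^T]] solves the Riccati equation requires
    differentiating an expectation. This is reduced to algebra: with the
    Gaussian versions of the conditional expectations, almost every path
    [Z_t = (X_t, Y_t)] satisfies one and the same linear equation with
    bounded deterministic coefficients, so that [Z_t = Psi_t^T Z_0] for a
    single differentiable matrix [Psi] ([common_propagator]). Hence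
    [E[Z_t Z_t^T] = Psi_t^T E[Z_0 Z_0^T] Psi_t] is differentiable; its
    diagonal blocks are constantly [A] and [B], since the marginals are
    preserved, and the derivative of its off-diagonal block is the Riccati
    vector field ([cross_corr_riccati]). Independence at time [0] and
    centering give [J 0 = 0].

    For optimality, let [T = B^(1/2) A^(-1/2)], a symmetric positive definite
    matrix which pushes [mu] forward to [nu]. Completing the square,
    [|x - y|^2 / 2] is a function of [x] plus a function of [y] plus
    [|T^(1/2) x - T^(-1/2) y|^2 / 2]. The integral of the first two terms is
    the same for all couplings, and the last term vanishes exactly on the
    graph of [T]. Hence the coupling [(x, T x)] is optimal, every optimal
    coupling is concentrated on that graph, and its cross-correlation is
    [A T = Jinf] ([is_OT_corr_linear_map], [gaussian_OT_corr]). *)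

Set Implicit Arguments.
Unset Strict Implicit.
Unset Printing Implicit Defensive.

Import Order.TTheory GRing.Theory Num.Theory.
Import numFieldNormedType.Exports.

Local Open Scope classical_set_scope.
Local Open Scope ring_scope.


(** * Simultaneous diagonalization and square roots *)

Section real_spectral_theorem.
Import mathcomp.real_closed.complex.

(** As a Hermitian complex matrix, [A] is diagonalizable with real spectrum:
    its minimal polynomial, which does not depend on the field, is a product
    of distinct factors [X - r] with [r] real. *)
Lemma symmetric_diagonalizable (R : rcfType) n (A : 'M[R]_n) :
  A^T = A -> diagonalizable A.
Proof.
case: n A => [|n] A As.
  exists 1%:M; first exact: unitmx1.
  by apply/is_diag_mxP => -[].
apply/diagonalizableP.
pose iota : {rmorphism R -> complex R} := real_complex R.
pose AC := map_mx iota A.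
have ACherm : AC \is hermsymmx.
  apply/is_hermitianmxP; rewrite expr0 scale1r; apply/matrixP => i j.
  by rewrite !mxE -{1}As mxE; apply/esym/conj_Creal/complex_realP; eexists.
have /hermitian_normalmx /orthomx_spectralP ACE := ACherm.
have Dreal := hermitian_spectral_diag_real ACherm.
set D := spectral_diag AC in ACE Dreal.
pose r i : R := Re (D 0 i).
have rE i : D 0 i = iota (r i).
  have /mxOverP /(_ 0 i) := Dreal.
  by rewrite /r; case: (D 0 i) => x y /= /complex_realP[k [-> ->]].
exists (undup [seq r i | i <- enum 'I_n.+1]); first exact: undup_uniq.
rewrite -(dvdp_map iota) -mxminpoly_map -/AC ACE.
rewrite -[_ *m _ *m _]conjVmx ?spectral_unit//.
rewrite mxminpoly_uconj ?unitmx_inv ?spectral_unit// mxminpoly_diag.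
rewrite (eq_map rE) (map_comp iota r) undup_map_inj; last exact: fmorph_inj.
rewrite big_map rmorph_prod/=.
under [X in _ %| X]eq_bigr do rewrite rmorphB/= map_polyX map_polyC.
exact: dvdpp.
Qed.

End real_spectral_theorem.

Section spectral_calculus.
Variables (R : rcfType) (n : nat).
Implicit Types (A B P : 'M[R]_n) (a b d e : 'I_n -> R).

(** [P] is only required to be invertible, not orthogonal: this is what
    simultaneous diagonalization provides, and symmetry is recovered in
    [specmx_sym_fun]. *)
Definition specmx P d : 'M[R]_n := invmx P *m diag_mx (\row_i d i) *m P.

Lemma specmxP P A : P \in unitmx -> is_diag_mx (conjmx P A) ->
  exists a, A = specmx P a.
Proof.
move=> Pu /(similar_diagLR Pu)[D ->]; exists (D 0).
rewrite /specmx conjVmx//; congr (_ *m diag_mx _ *m _).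
by apply/rowP => j; rewrite mxE.
Qed.

Lemma commuting_symmetric_specmx A B : A^T = A -> B^T = B ->
  A *m B = B *m A ->
  exists P a b, [/\ P \in unitmx, A = specmx P a & B = specmx P b].
Proof.
move=> As Bs AB.
have [_] := codiagonalizableP [:: A; B].
case: (codiagonalizableP [:: A; B]) => + _.
case=> [|P Pu /= /and3P[PA PB _] _].
  split=> [X Y|X]; rewrite !inE.
    by move=> /orP[]/eqP-> /orP[]/eqP->; rewrite /comm_mx.
  by move=> /orP[]/eqP->; exact: symmetric_diagonalizable.
have [a ->] := specmxP Pu PA.
have [b ->] := specmxP Pu PB.
by exists P, a, b.
Qed.

Lemma symmetric_specmx A : A^T = A ->
  exists P a, P \in unitmx /\ A = specmx P a.
Proof.
move=> As; have [P [a [_ [Pu AE _]]]] := commuting_symmetric_specmx As As erefl.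
by exists P, a.
Qed.

Variables (P : 'M[R]_n) (Pu : P \in unitmx).

Lemma specmxM d e : specmx P d *m specmx P e = specmx P (fun i => d i * e i).
Proof.
rewrite /specmx -!mulmxA (mulKVmx Pu) (mulmxA (diag_mx _) (diag_mx _)).
by rewrite mulmx_diag; congr (_ *m (diag_mx _ *m _)); apply/rowP => j; rewrite !mxE.
Qed.

Lemma specmxD d e : specmx P d + specmx P e = specmx P (fun i => d i + e i).
Proof.
rewrite /specmx -mulmxDl -mulmxDr -raddfD; congr (_ *m diag_mx _ *m _).
by apply/rowP => j; rewrite !mxE.
Qed.

Lemma specmxB d e : specmx P d - specmx P e = specmx P (fun i => d i - e i).
Proof.
rewrite /specmx -mulmxBl -mulmxBr -raddfB; congr (_ *m diag_mx _ *m _).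
by apply/rowP => j; rewrite !mxE.
Qed.

Lemma specmx1 : specmx P (fun=> 1) = 1%:M.
Proof.
rewrite /specmx (_ : \row_i 1 = const_mx 1) ?diag_const_mx.
  by rewrite mulmx1 mulVmx.
by apply/rowP => j; rewrite !mxE.
Qed.

Lemma eq_specmx d e : d =1 e -> specmx P d = specmx P e.
Proof. by move=> de; congr specmx; exact/funext. Qed.

Lemma specmxV d : (forall i, d i != 0) ->
  invmx (specmx P d) = specmx P (fun i => (d i)^-1).
Proof.
move=> d0; have dV : specmx P d *m specmx P (fun i => (d i)^-1) = 1%:M.
  by rewrite specmxM -specmx1; apply: eq_specmx => i; rewrite divff.
have [du _] := mulmx1_unit dV.
by rewrite -[RHS](mulKmx du) dV mulmx1.
Qed.

Lemma row_specmx i d : row i P *m specmx P d = d i *: row i P.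
Proof.
rewrite /specmx !mulmxA -row_mul mulmxV// row1 -rowE row_diag_mx mxE.
by rewrite -scalemxAl -rowE.
Qed.

Lemma specmx_entry d i j : specmx P d i j = \sum_k invmx P i k * d k * P k j.
Proof.
by rewrite mxE; apply: eq_bigr => k _; rewrite mul_mx_diag !mxE.
Qed.


(** Conjugating by [P] turns the transpose into the adjoint for the Gram
    matrix [P *m P^T], so symmetry means commutation with that matrix. *)
Lemma specmx_symP d :
  (specmx P d)^T = specmx P d <->
  (forall i j, (P *m P^T) i j * d j = d i * (P *m P^T) i j).
Proof.
have PTu : P^T \in unitmx by rewrite unitmx_tr.
have entry i j : (P *m P^T *m diag_mx (\row_k d k)) i j = (P *m P^T) i j * d j.
  by rewrite mul_mx_diag !mxE.
have entry' i j : (diag_mx (\row_k d k) *m (P *m P^T)) i j = d i * (P *m P^T) i j.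
  by rewrite mul_diag_mx !mxE.
rewrite /specmx !trmx_mul tr_diag_mx trmx_inv.
split=> [ds i j|ds].
  rewrite -entry -entry'; congr (fun_of_matrix _ i j).
  move/(congr1 (fun M => P *m M *m P^T)): ds.
  by rewrite !mulmxA mulmxV// mul1mx mulmxKV.
have {}ds : P *m P^T *m diag_mx (\row_k d k) = diag_mx (\row_k d k) *m (P *m P^T).
  by apply/matrixP => i j; rewrite entry entry'.
apply: (can_inj (mulKmx Pu)); apply: (can_inj (mulmxK PTu)).
by rewrite !mulmxA mulmxV// mul1mx mulmxKV// ds mulmxA.
Qed.

(** Wherever the Gram matrix has a nonzero entry [(i, j)], the symmetry of the
    two given matrices forces [a i = a j] and [b i = b j]. *)
Lemma specmx_sym_fun a b (f : R -> R -> R) :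
  (specmx P a)^T = specmx P a -> (specmx P b)^T = specmx P b ->
  (specmx P (fun i => f (a i) (b i)))^T = specmx P (fun i => f (a i) (b i)).
Proof.
move=> /specmx_symP as_ /specmx_symP bs_; apply/specmx_symP => i j.
have [->|G0] := eqVneq ((P *m P^T) i j) 0; first by rewrite mul0r mulr0.
have -> : a i = a j by move: (as_ i j); rewrite mulrC => /mulIf ->.
have -> : b i = b j by move: (bs_ i j); rewrite mulrC => /mulIf ->.
by rewrite mulrC.
Qed.

Lemma dotmx_gt0 (v : 'rV[R]_n) : v != 0 -> 0 < (v *m v^T) 0 0.
Proof.
move=> v0; rewrite lt_def mxE; apply/andP; split; last first.
  by apply: sumr_ge0 => i _; rewrite mxE -expr2 sqr_ge0.
apply: contra v0 => /eqP v0; apply/eqP/rowP => j; rewrite mxE; apply/eqP.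
have v2 i : true -> 0 <= v 0 i * v^T i 0 by rewrite mxE -expr2 sqr_ge0.
have /eqP : v 0 j * v^T j 0 = 0 by exact: (psumr_eq0P v2 v0).
by rewrite mxE -expr2 sqrf_eq0.
Qed.

Lemma row_unit_neq0 i : row i P != 0.
Proof.
have : row_free P by rewrite row_free_unit.
move=> /row_freeP[B PB]; apply/eqP => Pi0.
have := congr1 (row i) PB; rewrite row_mul Pi0 mul0mx => /rowP /(_ i).
by rewrite !mxE eqxx => /esym /eqP; rewrite oner_eq0.
Qed.

End spectral_calculus.

Section positive_definite.
Variables (R : realType) (n : nat).
Implicit Types (A B C P : 'M[R]_n) (a b d e : 'I_n -> R).

Lemma pdmx_specmx_gt0 P a : P \in unitmx -> pdmx (specmx P a) ->
  forall i, 0 < a i.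
Proof.
move=> Pu [_ pda] i; have v0 := row_unit_neq0 Pu i.
have := pda (row i P)^T; rewrite trmxK row_specmx//.
rewrite -scalemxAl mxE pmulr_lgt0 ?dotmx_gt0//; apply.
by apply: contra v0 => /eqP/(congr1 trmx); rewrite trmxK trmx0 => ->.
Qed.

Lemma psdmx_sqr A : A^T = A -> psdmx (A *m A).
Proof.
move=> As; split; first by rewrite trmx_mul As.
move=> x; rewrite mulmxA -[_ *m x]mulmxA -{1}As -trmx_mul mxE sumr_ge0// => i _.
by rewrite mxE -expr2 sqr_ge0.
Qed.

(** The matrix is the square of a symmetric one, by [specmx_sym_fun] for
    [sqrt \o f]. *)
Lemma specmx_psd P a b (f : R -> R -> R) : P \in unitmx ->
  (specmx P a)^T = specmx P a -> (specmx P b)^T = specmx P b ->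
  (forall i, 0 <= f (a i) (b i)) -> psdmx (specmx P (fun i => f (a i) (b i))).
Proof.
move=> Pu as_ bs f0.
have -> : specmx P (fun i => f (a i) (b i)) =
    specmx P (fun i => Num.sqrt (f (a i) (b i))) *m
    specmx P (fun i => Num.sqrt (f (a i) (b i))).
  by rewrite specmxM//; apply: eq_specmx => i; rewrite -expr2 sqr_sqrtr.
apply: psdmx_sqr.
exact: (@specmx_sym_fun _ _ _ Pu a b (fun x y => Num.sqrt (f x y))).
Qed.

(** On an eigenvector [p] of [E = B - C] with eigenvalue [e], the identity
    [E *m B + C *m E = 0] gives [e * (p B p^T + p C p^T) = 0]; were [e]
    nonzero, both quadratic forms would vanish at [p], hence so would
    [p E p^T = e |p|^2]. *)
Lemma psdmx_sqr_inj B C : psdmx B -> psdmx C -> B *m B = C *m C -> B = C.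
Proof.
move=> [Bs B0] [Cs C0] BC; apply/eqP; rewrite -subr_eq0; apply/eqP.
have Es : (B - C)^T = B - C by rewrite linearB/= Bs Cs.
have [P [e [Pu EE]]] := symmetric_specmx Es.
suff e0 i : e i = 0.
  rewrite EE (@eq_specmx _ _ _ _ (fun i => e i - e i)) -?specmxB ?subrr//.
  by move=> i; rewrite subrr.
apply/eqP; apply: contraT => ei0.
have v0 := row_unit_neq0 Pu i; set p := row i P in v0.
have pE : p *m (B - C) = e i *: p by rewrite EE row_specmx.
have Ep : (B - C) *m p^T = e i *: p^T by rewrite -{1}Es -trmx_mul pE linearZ.
have Bp : 0 <= (p *m B *m p^T) 0 0 by have := B0 p^T; rewrite trmxK.
have Cp : 0 <= (p *m C *m p^T) 0 0 by have := C0 p^T; rewrite trmxK.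
have sum0 : (p *m B *m p^T) 0 0 + (p *m C *m p^T) 0 0 = 0.
  apply: (mulfI ei0); rewrite mulr0.
  have : p *m ((B - C) *m B + C *m (B - C)) *m p^T = 0.
    by rewrite mulmxBl mulmxBr BC addrA subrK subrr mulmx0 mul0mx.
  have -> : p *m ((B - C) *m B + C *m (B - C)) *m p^T =
      e i *: (p *m B *m p^T + p *m C *m p^T).
    rewrite mulmxDr mulmxDl scalerDr mulmxA pE -!scalemxAl; congr (_ + _).
    by rewrite -!mulmxA Ep -!scalemxAr.
  by move=> /matrixP /(_ 0 0); rewrite !mxE.
have : e i * (p *m p^T) 0 0 = 0.
  have -> : e i * (p *m p^T) 0 0 = (p *m B *m p^T) 0 0 - (p *m C *m p^T) 0 0.
    transitivity ((p *m (B - C) *m p^T) 0 0).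
      by rewrite pE -scalemxAl !mxE.
    by rewrite mulmxBr mulmxBl !mxE.
  move/eqP: sum0; rewrite paddr_eq0// => /andP[/eqP-> /eqP->].
  by rewrite subrr.
by move/eqP; rewrite mulf_eq0 (negbTE ei0)/= gt_eqF ?dotmx_gt0.
Qed.

Lemma sqrtmxE B A : psdmx B -> B *m B = A -> sqrtmx A = B.
Proof.
move=> Bp <-; rewrite /sqrtmx.
have [] := @xgetPex _ 0 [set X | psdmx X /\ X *m X = B *m B]; first by exists B.
by move=> psdX XB; exact: psdmx_sqr_inj.
Qed.

Lemma specmx_sqrt P a b (f : R -> R -> R) : P \in unitmx ->
  (specmx P a)^T = specmx P a -> (specmx P b)^T = specmx P b ->
  (forall i, 0 <= f (a i) (b i)) ->
  sqrtmx (specmx P (fun i => f (a i) (b i))) =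
  specmx P (fun i => Num.sqrt (f (a i) (b i))).
Proof.
move=> Pu as_ bs f0; apply: sqrtmxE.
  by apply: (@specmx_psd P a b (fun x y => Num.sqrt (f x y))).
by rewrite specmxM//; apply: eq_specmx => i; rewrite -expr2 sqr_sqrtr.
Qed.

Lemma commuting_sqrtmx_formula P a b : P \in unitmx ->
  pdmx (specmx P a) -> pdmx (specmx P b) ->
  sqrtmx (specmx P a)
    *m sqrtmx (sqrtmx (specmx P a) *m specmx P b *m sqrtmx (specmx P a))
    *m invmx (sqrtmx (specmx P a)) =
  specmx P (fun i => Num.sqrt (a i * b i)).
Proof.
move=> Pu apd bpd; have a0 := pdmx_specmx_gt0 Pu apd.
have b0 := pdmx_specmx_gt0 Pu bpd.
have [as_ _] := apd; have [bs _] := bpd.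
have -> : sqrtmx (specmx P a) = specmx P (fun i => Num.sqrt (a i)).
  by apply: (@specmx_sqrt P a b (fun x _ => x)) => // i; exact: ltW.
have -> : specmx P (fun i => Num.sqrt (a i)) *m specmx P b
    *m specmx P (fun i => Num.sqrt (a i)) = specmx P (fun i => a i * b i).
  rewrite !specmxM//; apply: eq_specmx => i.
  by rewrite mulrAC -expr2 sqr_sqrtr//; exact: ltW.
have -> : sqrtmx (specmx P (fun i => a i * b i)) =
    specmx P (fun i => Num.sqrt (a i * b i)).
  apply: (@specmx_sqrt P a b (fun x y => x * y)) => // i.
  by rewrite mulr_ge0// ltW.
rewrite specmxV// ?specmxM//; last by move=> i; rewrite gt_eqF// sqrtr_gt0.
apply: eq_specmx => i; rewrite mulrAC divff ?mul1r// gt_eqF// sqrtr_gt0//.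
Qed.

End positive_definite.

Section sqrt_of_pdmx.
Context (R : realType) (n : nat).

Lemma pdmx_sqrtmx (S : 'M[R]_n) : pdmx S ->
  [/\ psdmx (sqrtmx S), sqrtmx S *m sqrtmx S = S & sqrtmx S \in unitmx].
Proof.
move=> Spd; have [Ss _] := Spd.
have [P [a [Pu SE]]] := symmetric_specmx Ss; rewrite SE in Spd Ss *.
have a0 := pdmx_specmx_gt0 Pu Spd.
have sE := @specmx_sqrt _ _ P a a (fun x _ => x) Pu Ss Ss (fun i => ltW (a0 i)).
have sqE : sqrtmx (specmx P a) *m sqrtmx (specmx P a) = specmx P a.
  rewrite sE specmxM//; apply: eq_specmx => i.
  by rewrite -expr2 sqr_sqrtr// ltW.
split=> //.
  by rewrite sE; apply: (@specmx_psd _ _ P a a (fun x _ => Num.sqrt x)).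
have [] := @mulmx1_unit _ _ (sqrtmx (specmx P a))
  (specmx P (fun i => (Num.sqrt (a i))^-1)) => //.
rewrite sE specmxM// -(specmx1 Pu); apply: eq_specmx => i.
by rewrite divff// gt_eqF// sqrtr_gt0.
Qed.

Lemma pdmx_invmx_sym (S : 'M[R]_n) : pdmx S -> (invmx S)^T = invmx S.
Proof. by move=> [Ss _]; rewrite trmx_inv Ss. Qed.

End sqrt_of_pdmx.

(** * Differentiable curves on the half-line and Gronwall's inequality *)

Section evolution.
Variable R : realType.
Implicit Types (f g : R -> R) (t c : R).

(** A curve on [0, +oo[ has only a one-sided derivative at [0]; for the mean
    value theorem, right continuity there is enough. *)
Definition evolves f (f' : R -> R) :=
  (f t @[t --> 0^'+] --> f 0) /\ forall t, 0 < t -> is_derive t 1 f (f' t).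

Lemma eq_evolves f g f' g' : f =1 g -> (forall t, 0 < t -> f' t = g' t) ->
  evolves f f' -> evolves g g'.
Proof.
move=> /funext <- fg' [f0 df]; split=> // t t0.
by rewrite -fg'//; exact: df.
Qed.

Lemma evolves_cst c : evolves (fun=> c) (fun=> 0).
Proof. by split=> [|t _]; [exact: cvg_cst|exact: is_derive_cst]. Qed.

Lemma evolvesD f g f' g' : evolves f f' -> evolves g g' ->
  evolves (fun t => f t + g t) (fun t => f' t + g' t).
Proof.
move=> [f0 df] [g0 dg]; split=> [|t t0]; first exact: cvgD.
by apply: is_deriveD; [exact: df|exact: dg].
Qed.

Lemma evolvesM f g f' g' : evolves f f' -> evolves g g' ->
  evolves (fun t => f t * g t) (fun t => f' t * g t + f t * g' t).
Proof.
move=> [f0 df] [g0 dg]; split=> [|t t0]; first exact: cvgM.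
have dft := df _ t0; have dgt := dg _ t0.
apply: (is_derive_eq (is_deriveM dft dgt)).
by rewrite addrC /GRing.scale/= [g t * _]mulrC.
Qed.

Lemma evolvesZ c f f' : evolves f f' ->
  evolves (fun t => c * f t) (fun t => c * f' t).
Proof.
move=> ef; apply: eq_evolves (evolvesM (evolves_cst c) ef) => // t _.
by rewrite mul0r add0r.
Qed.

Lemma evolvesB f g f' g' : evolves f f' -> evolves g g' ->
  evolves (fun t => f t - g t) (fun t => f' t - g' t).
Proof.
move=> ef eg; apply: eq_evolves (evolvesD ef (evolvesZ (-1) eg)) => [t|t _];
  by rewrite mulN1r.
Qed.

Lemma evolves_sum (I : Type) (r : seq I) (F F' : I -> R -> R) :
  (forall i, evolves (F i) (F' i)) ->
  evolves (fun t => \sum_(i <- r) F i t) (fun t => \sum_(i <- r) F' i t).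
Proof.
move=> eF; elim: r => [|i r IH].
  by apply: eq_evolves (evolves_cst 0) => [t|t _]; rewrite big_nil.
by apply: eq_evolves (evolvesD (eF i) IH) => [t|t _]; rewrite big_cons.
Qed.

Lemma is_derive_evolves f f' : (forall t, is_derive t 1 f (f' t)) -> evolves f f'.
Proof.
move=> df; split=> [|t _//]; apply: cvg_at_right_filter.
by apply: differentiable_continuous; apply/derivable1_diffP; case: (df 0).
Qed.

Lemma evolves_continuous f f' t : evolves f f' -> 0 < t -> {for t, continuous f}.
Proof.
move=> [_ df] t0; apply: differentiable_continuous; apply/derivable1_diffP.
by case: (df t t0).
Qed.

Lemma is_derive_expRM c t :
  is_derive t 1 (fun s => expR (c * s)) (expR (c * t) * c).
Proof.
have dc : is_derive t 1 (fun s => c * s) c.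
  have := @is_deriveZ _ _ _ (@id R) c t 1 1 (is_derive_id _ _).
  by rewrite /GRing.scale/= mulr1.
exact: (is_derive1_comp (is_derive_expR _) dc).
Qed.

Lemma gronwall0 f f' c : evolves f f' -> f 0 <= 0 ->
  (forall t, 0 < t -> f' t <= c * f t) -> forall t, 0 <= t -> f t <= 0.
Proof.
move=> ef f0 f'le t; rewrite le_eqVlt => /predU1P[<-//|t0].
have [g0 dg] := evolvesM (is_derive_evolves (is_derive_expRM (- c))) ef.
set g := (fun t => _) in g0 dg.
suff : g t <= g 0.
  rewrite /g mulr0 expR0 mul1r => /le_trans/(_ f0).
  by rewrite pmulr_rle0// expR_gt0.
apply: (@ler0_derive1_le_cc R g 0 t) => //.
- by move=> x; rewrite in_itv/= => /andP[x0 _]; case: (dg x x0).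
- move=> x; rewrite in_itv/= => /andP[x0 _].
  rewrite derive1E; have -> := derive_val (is_derive := dg x x0).
  rewrite mulrAC -mulrA -mulrDr pmulr_rle0 ?expR_gt0//.
  by rewrite mulrC mulNr addrC subr_le0 f'le.
- apply/continuous_within_itvP => //; split=> //.
    move=> x; rewrite in_itv/= => /andP[x0 _].
    exact: (evolves_continuous (conj g0 dg)).
  by apply: cvg_at_left_filter; exact: (evolves_continuous (conj g0 dg)).
- by rewrite in_itv/= lexx ltW.
- by rewrite in_itv/= lexx ltW.
- exact: ltW.
Qed.

(** The sum of the [u i ^+ 2] satisfies the hypotheses of [gronwall0], with the
    constant [2 * c * #|I|], since [2 |u i| |u j| <= u i ^ 2 + u j ^ 2]. *)
Lemma vector_gronwall0 (I : finType) (u u' : I -> R -> R) c : 0 <= c ->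
  (forall i, evolves (u i) (u' i)) -> (forall i, u i 0 = 0) ->
  (forall i t, 0 < t -> `|u' i t| <= c * \sum_j `|u j t|) ->
  forall i t, 0 <= t -> u i t = 0.
Proof.
move=> c0 eu u0 u'le i t t0.
have ef := evolves_sum (index_enum I) (fun j => evolvesM (eu j) (eu j)).
have f0 : \sum_j u j 0 * u j 0 <= 0 by rewrite big1// => j _; rewrite u0 mul0r.
have fle s : 0 < s -> \sum_j (u' j s * u j s + u j s * u' j s) <=
    (2 * c * #|I|%:R) * \sum_j u j s * u j s.
  move=> s0; set S := \sum_j u j s * u j s.
  apply: (@le_trans _ _ (\sum_j c * (#|I|%:R * (u j s * u j s) + S))).
    apply: ler_sum => j _; rewrite [u j s * u' j s]mulrC -mulr2n.
    apply: (le_trans (ler_norm _)); rewrite normrMn normrM.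
    have := ler_wpM2r (normr_ge0 (u j s)) (u'le j s s0).
    rewrite -mulrA => /(ler_wMn2r 2) h; apply: (le_trans h).
    rewrite -mulrnAr ler_wpM2l// mulr_suml -sumrMnl.
    rewrite mulr_natl -sumr_const -big_split/=; apply: ler_sum => k _.
    rewrite -(ger0_norm (sqr_ge0 (u j s)) : _ = u j s * u j s).
    rewrite -(ger0_norm (sqr_ge0 (u k s)) : _ = u k s * u k s) !normrM.
    have := sqr_ge0 (`|u j s| - `|u k s|); nra.
  rewrite -mulr_sumr big_split/= sumr_const -mulr_sumr -/S -mulr_natl.
  by rewrite le_eqVlt; apply/orP; left; apply/eqP; ring.
have S0 := gronwall0 ef f0 fle t0.
have /eqP : u i t * u i t = 0.
  apply: (@psumr_eq0P _ _ xpredT (fun j => u j t * u j t)) => //.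
    by move=> j _; rewrite -expr2 sqr_ge0.
  apply/eqP; rewrite eq_le S0 sumr_ge0// => j _.
  by rewrite -expr2 sqr_ge0.
by rewrite mulf_eq0 orbb => /eqP.
Qed.

(** This is [tanh (c t)], written with a single exponential. *)
Definition tanhM c t := 1 - 2 / (expR (2 * c * t) + 1).

Lemma tanhM0 c : tanhM c 0 = 0.
Proof. by rewrite /tanhM mulr0 expR0 -mulr2n divff ?subrr. Qed.

Lemma tanhM_evolves c : evolves (tanhM c) (fun t => c * (1 - tanhM c t ^+ 2)).
Proof.
apply: is_derive_evolves => t.
have e0 : expR (2 * c * t) + 1 != 0 by rewrite gt_eqF// addr_gt0// expR_gt0.
have d1 : is_derive t 1 (fun t => expR (2 * c * t) + 1)
    (expR (2 * c * t) * (2 * c) + 0).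
  exact: is_deriveD (is_derive_expRM (2 * c) t) (is_derive_cst (1 : R) t (1 : R)).
have d2 := @is_deriveV _ (fun t => expR (2 * c * t) + 1) t _ _ e0 d1.
have d3 := is_deriveB (is_derive_cst (1 : R) t (1 : R)) (is_deriveZ (2 : R) d2).
apply: (is_derive_eq d3).
rewrite /tanhM /GRing.scale/=; field.
by rewrite e0.
Qed.

Lemma tanhM_bound c t : `|tanhM c t| <= 1.
Proof.
have e0 := expR_gt0 (2 * c * t).
have e1 : 0 < expR (2 * c * t) + 1 by rewrite addr_gt0.
rewrite /tanhM ler_norml; apply/andP; split.
  by rewrite lerBrDr addrC lerBlDr ler_pdivrMr//; nra.
by rewrite lerBlDr lerDl divr_ge0// ltW.
Qed.

Lemma tanhM_cvg c : 0 < c -> tanhM c t @[t --> +oo] --> (1 : R).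
Proof.
move=> c0; rewrite -[X in _ --> X]subr0; apply: cvgB; first exact: cvg_cst.
apply/cvgrPdist_le => e e_gt0.
near=> t.
rewrite sub0r normrN ger0_norm; last by rewrite divr_ge0// addr_ge0// expR_ge0.
have h : 1 + 2 * c * t <= expR (2 * c * t) by exact: expR_ge1Dx.
rewrite ler_pdivrMr; last by rewrite ltr_wpDl// expR_ge0.
apply: (@le_trans _ _ (e * (2 * c * t))).
  rewrite -ler_pdivrMl// -ler_pdivrMl; last by rewrite mulr_gt0.
  by near: t; apply: nbhs_pinfty_ge; rewrite num_real.
by rewrite ler_pM2l//; lra.
Unshelve. all: by end_near. Qed.

Definition mx_evolves m n (M M' : R -> 'M[R]_(m, n)) :=
  forall i j, evolves (fun t => M t i j) (fun t => M' t i j).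

Lemma mx_evolvesM m n p (M M' : R -> 'M[R]_(m, n)) (N N' : R -> 'M[R]_(n, p)) :
  mx_evolves M M' -> mx_evolves N N' ->
  mx_evolves (fun t => M t *m N t) (fun t => M' t *m N t + M t *m N' t).
Proof.
move=> eM eN i j.
have := evolves_sum (index_enum 'I_n) (fun k => evolvesM (eM i k) (eN k j)).
apply: eq_evolves => [t|t _]; first by rewrite mxE.
by rewrite !mxE -big_split.
Qed.

Lemma mx_evolves_cst m n (M : 'M[R]_(m, n)) : mx_evolves (fun=> M) (fun=> 0).
Proof.
by move=> i j; apply: eq_evolves (evolves_cst (M i j)) => // t _; rewrite mxE.
Qed.

Lemma mx_evolves_tr m n (M M' : R -> 'M[R]_(m, n)) :
  mx_evolves M M' -> mx_evolves (fun t => (M t)^T) (fun t => (M' t)^T).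
Proof. by move=> eM i j; apply: eq_evolves (eM j i) => [t|t _]; rewrite mxE. Qed.

Lemma mx_evolvesB m n (M M' N N' : R -> 'M[R]_(m, n)) :
  mx_evolves M M' -> mx_evolves N N' ->
  mx_evolves (fun t => M t - N t) (fun t => M' t - N' t).
Proof.
by move=> eM eN i j; apply: eq_evolves (evolvesB (eM i j) (eN i j)) => [t|t _];
  rewrite !mxE.
Qed.

Lemma eq_mx_evolves m n (M N M' N' : R -> 'M[R]_(m, n)) : M =1 N ->
  (forall t, 0 < t -> M' t = N' t) -> mx_evolves M M' -> mx_evolves N N'.
Proof.
move=> MN MN' eM i j; apply: eq_evolves (eM i j) => [t|t t0]; rewrite ?MN//.
by rewrite MN'.
Qed.

End evolution.

Section is_derive_ge0.
Variables (R : realType) (n : nat) (f v : R -> 'cV[R]_n).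
Hypothesis df : forall t, 0 <= t -> is_derive_ge0 f t (v t).

Lemma is_derive_ge0_coord i t A : 0 <= t -> nbhs (v t i 0) A ->
  \forall h \near 0, h != 0 -> 0 <= t + h -> A (h^-1 * (f (t + h) i 0 - f t i 0)).
Proof.
move=> t0 nA.
have := cvg_comp _ _ (df t0) (@coord_continuous _ _ _ i 0 (v t)).
move=> /(_ A nA) h.
have {}h : nbhs 0 [set x | x != 0 -> 0 <= t + x ->
    A ((x^-1 *: (f (t + x) - f t)) i 0)] := h.
by apply: filterS h => x Ax x0 tx; have := Ax x0 tx; rewrite !mxE.
Qed.

Lemma is_derive_ge0_evolves : mx_evolves f v.
Proof.
move=> i j; rewrite (ord1 j); split=> [|t t0].
  have h : h^-1 * (f h i 0 - f 0 i 0) @[h --> 0^'+] --> v 0 i 0.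
    move=> A /(is_derive_ge0_coord (lexx 0)); apply: filterS => x Ax x0.
    by have := Ax; rewrite add0r; apply; rewrite ?gt_eqF// ltW.
  have : h * (h^-1 * (f h i 0 - f 0 i 0)) + f 0 i 0 @[h --> 0^'+] -->
      0 * v 0 i 0 + f 0 i 0.
    apply: cvgD; last exact: cvg_cst.
    by apply: cvgM h; apply: cvg_at_right_filter; exact: cvg_id.
  rewrite mul0r add0r; apply: cvg_trans; apply: near_eq_cvg; clear h.
  near=> x; rewrite mulrA divff ?mul1r ?subrK//.
have h : h^-1 *: (f (h *: 1 + t) i 0 - f t i 0) @[h --> 0^'] --> v t i 0.
  move=> A /(is_derive_ge0_coord (ltW t0)).
  have tx0 : \forall x \near (0 : R), 0 <= t + x.
    exists t => //= x /=; rewrite sub0r normrN => /ltr_normlP[xt _].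
    by rewrite -lerBlDl sub0r -(opprK x) lerN2 ltW.
  apply: filterS2 tx0 => x tx Ax x0 /=.
  by rewrite [x *: 1]mulr1 [x + t]addrC; exact: Ax.
split; first by apply/cvg_ex; exists (v t i 0).
exact/cvg_lim.
Unshelve. all: by end_near. Qed.

End is_derive_ge0.

(** * Moments and symmetry of the standard normal law *)

Section normal_second_moment.
Variable R : realType.
Local Notation lambda := (@lebesgue_measure R).
Local Notation psi := (normal_fun (0 : R) 1).

Lemma normal_funE x : psi x = expR (- (x ^+ 2 / 2)).
Proof. by rewrite /normal_fun subr0 expr1n mulNr. Qed.

Lemma continuous_normal_fun : continuous psi.
Proof.
rewrite (_ : psi = fun x => expR (- (x ^+ 2 / 2))); last first.
  by apply/funext => x; rewrite normal_funE.
move=> x; apply: (cvg_comp _ expR); last exact: continuous_expR.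
by apply: cvgN; apply: cvgM; [exact: exprn_continuous|exact: cvg_cst].
Qed.

Lemma is_derive_normal_fun (x : R) : is_derive x 1 psi (- x * psi x).
Proof.
have dx := is_derive_id x (1 : R).
have d1 : is_derive x 1 (fun x : R => - (2^-1 * (x * x))) (- x).
  apply: (is_derive_eq (is_deriveN (is_deriveZ (2^-1 : R) (is_deriveM dx dx)))).
  by rewrite /GRing.scale/= mulr1; field.
rewrite (_ : psi = expR \o (fun x => - (2^-1 * (x * x)))); last first.
  by apply/funext => y; rewrite normal_funE /= mulrC.
by apply: (is_derive_eq (is_derive1_comp (is_derive_expR _) d1)); rewrite /= mulrC.
Qed.

Lemma cvg_M_normal_fun : x * psi x @[x --> +oo] --> (0 : R).
Proof.
apply/cvgrPdist_le => e e0; near=> x.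
have x0 : 0 < x by near: x; apply: nbhs_pinfty_gt; rewrite num_real.
rewrite sub0r normrN ger0_norm; last by rewrite mulr_ge0 ?expR_ge0// ltW.
rewrite normal_funE expRN ler_pdivrMr ?expR_gt0//.
have h : 1 + x ^+ 2 / 2 <= expR (x ^+ 2 / 2) by exact: expR_ge1Dx.
have xe : 2 / e <= x by near: x; apply: nbhs_pinfty_ge; rewrite num_real.
have {}xe : 2 <= x * e by rewrite -ler_pdivrMr.
by apply: (@le_trans _ _ (e * (1 + x ^+ 2 / 2))); [nra|rewrite ler_pM2l].
Unshelve. all: by end_near. Qed.

Lemma continuous_sqrM_normal_fun : continuous (fun x : R => x ^+ 2 * psi x).
Proof.
by move=> x; apply: cvgM; [exact: exprn_continuous|exact: continuous_normal_fun].
Qed.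

Lemma is_derive_expRN (x : R) : is_derive x 1 (fun x => expR (- x)) (- expR (- x)).
Proof.
have := is_derive1_comp (is_derive_expR _) (is_deriveNid x (1 : R)).
by rewrite mulrN1.
Qed.

Lemma continuous_expRN : continuous (fun x : R => expR (- x)).
Proof.
move=> x; apply: differentiable_continuous; apply/derivable1_diffP.
by case: (is_derive_expRN x).
Qed.

Lemma integral0y_expRN :
  (\int[lambda]_(x in `[0%R, +oo[) (2 * expR (- x))%:E = 2%:E)%E.
Proof.
have d (x : R) : is_derive x 1 (fun x => - 2 * expR (- x)) (2 * expR (- x)).
  have := is_deriveZ (- 2 : R) (is_derive_expRN x).
  by rewrite /GRing.scale/= mulrN mulNr opprK.
rewrite (@ge0_continuous_FTC2y R _ (fun x => - 2 * expR (- x)) 0 0).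
- by rewrite oppr0 expR0 mulr1 -EFinB sub0r opprK.
- by move=> x _; rewrite mulr_ge0 ?expR_ge0.
- apply: continuous_subspaceT => x.
  by apply: cvgM; [exact: cvg_cst|exact: continuous_expRN].
- rewrite -[X in _ --> X](mulr0 (- 2)).
  by apply: cvgM; [exact: cvg_cst|exact: cvgr_expR].
- by move=> x _; case: (d x).
- apply: cvg_at_right_filter; apply: cvgM; [exact: cvg_cst|exact: continuous_expRN].
- by move=> x _; rewrite derive1E; exact: derive_val.
Qed.

(** [(x^2 - 1) psi] has the primitive [- x psi], which vanishes at [0] and at
    infinity. It changes sign, so [2 exp(-x)] is added to both sides in order
    to integrate only nonnegative functions; this works because
    [1 - x^2 <= 2 (1 - x) <= 2 exp(-x)] and [0 < psi <= 1]. *)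
Lemma integral0y_sqr_normal_fun :
  (\int[lambda]_(x in `[0%R, +oo[) (x ^+ 2 * psi x)%:E =
   \int[lambda]_(x in `[0%R, +oo[) (psi x)%:E)%E.
Proof.
have mpsi : measurable_fun `[(0 : R), +oo[ (EFin \o psi).
  by apply/measurable_EFinP; apply: measurable_funTS; exact: measurable_normal_fun.
have mx2 : measurable_fun `[(0 : R), +oo[ (EFin \o (fun x : R => x ^+ 2 * psi x)).
  apply/measurable_EFinP; apply: measurable_funTS.
  by apply: continuous_measurable_fun; exact: continuous_sqrM_normal_fun.
have mexp : measurable_fun `[(0 : R), +oo[ (EFin \o (fun x : R => 2 * expR (- x))).
  apply/measurable_EFinP; apply: measurable_funTS.
  apply: continuous_measurable_fun => x.
  by apply: cvgM; [exact: cvg_cst|exact: continuous_expRN].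
have d (x : R) : is_derive x 1 (fun x => - (x * psi x) - 2 * expR (- x))
    ((x ^+ 2 - 1) * psi x + 2 * expR (- x)).
  have d1 := is_deriveM (is_derive_id x (1 : R)) (is_derive_normal_fun x).
  have := is_deriveB (is_deriveN d1) (is_deriveZ (2 : R) (is_derive_expRN x)).
  move=> d2; apply: (is_derive_eq d2).
  by rewrite /GRing.scale/=; ring.
have g0 (x : R) : 0 <= x -> 0 <= (x ^+ 2 - 1) * psi x + 2 * expR (- x).
  move=> x0.
  have p0 : 0 < psi x by rewrite expR_gt0.
  have p1 : psi x <= 1.
    by rewrite normal_funE -expR0 ler_expR oppr_le0 mulr_ge0 ?sqr_ge0.
  have h : 1 + - x <= expR (- x) by exact: expR_ge1Dx.
  have e0 : 0 < expR (- x) by rewrite expR_gt0.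
  have [x1|x1] := leP x 1.
    have : 0 <= (1 - x ^+ 2) * (1 - psi x).
      by rewrite mulr_ge0 ?subr_ge0// exprn_ile1.
    have := sqr_ge0 (1 - x); lra.
  have x21 : 0 <= x ^+ 2 - 1 by rewrite subr_ge0 exprn_ege1// ltW.
  by apply: addr_ge0; apply: mulr_ge0 => //; exact: ltW.
have Ig : (\int[lambda]_(x in `[0%R, +oo[)
    ((x ^+ 2 - 1) * psi x + 2 * expR (- x))%:E = 2%:E)%E.
  have cF (x : R) :
      {for x, continuous (fun x : R => - (x * psi x) - 2 * expR (- x))}.
    apply: differentiable_continuous; apply/derivable1_diffP.
    by case: (d x).
  rewrite (@ge0_continuous_FTC2y R _
    (fun x => - (x * psi x) - 2 * expR (- x)) 0 0).
  - by rewrite mul0r oppr0 expR0 mulr1 -EFinB !sub0r opprK.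
  - exact: g0.
  - apply: continuous_subspaceT => x.
    apply: cvgD; apply: cvgM;
      [|exact: continuous_normal_fun| |exact: continuous_expRN].
      by apply: cvgB; [exact: exprn_continuous|exact: cvg_cst].
    exact: cvg_cst.
  - rewrite -[X in _ --> X](_ : - 0 - 2 * 0 = 0); last first.
      by rewrite mulr0 subr0 oppr0.
    apply: cvgB; first by apply: cvgN; exact: cvg_M_normal_fun.
    by apply: cvgM; [exact: cvg_cst|exact: cvgr_expR].
  - by move=> x _; case: (d x).
  - by apply: cvg_at_right_filter; exact: cF.
  - by move=> x _; rewrite derive1E; exact: derive_val.
have mg : measurable_fun `[(0 : R), +oo[
    (EFin \o (fun x : R => (x ^+ 2 - 1) * psi x + 2 * expR (- x))).
  rewrite (_ : EFin \o _ = fun x =>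
    ((x ^+ 2 * psi x)%:E - (psi x)%:E + (2 * expR (- x))%:E)%E).
    by apply: emeasurable_funD => //; apply: emeasurable_funB.
  by apply/funext => x /=; rewrite -EFinB -EFinD mulrBl mul1r.
have := congr1 (fun z => z - 2%:E)%E (_ :
  (\int[lambda]_(x in `[0%R, +oo[) (x ^+ 2 * psi x)%:E + 2%:E =
  \int[lambda]_(x in `[0%R, +oo[) (psi x)%:E + 2%:E)%E).
rewrite !addeK//; apply.
rewrite -[in LHS]integral0y_expRN -[in RHS]Ig -!ge0_integralD//=.
- by apply: eq_integral => x _; rewrite -!EFinD; congr EFin; ring.
- by move=> x _; rewrite lee_fin expR_ge0.
- by move=> x; rewrite in_itv/= andbT lee_fin; exact: g0.
- by move=> x _; rewrite lee_fin mulr_ge0 ?sqr_ge0 ?expR_ge0.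
Qed.

Lemma integral_sqr_normal_pdf :
  (\int[lambda]_x (x ^+ 2 * normal_pdf (0 : R) 1 x)%:E = 1)%E.
Proof.
have peak0 : 0 <= normal_peak (1 : R) by exact: normal_peak_ge0.
have mpsi D : measurable_fun D (EFin \o psi).
  by apply/measurable_EFinP; apply: measurable_funTS; exact: measurable_normal_fun.
have mx2 D : measurable_fun D (EFin \o (fun x : R => x ^+ 2 * psi x)).
  apply/measurable_EFinP; apply: measurable_funTS.
  by apply: continuous_measurable_fun; exact: continuous_sqrM_normal_fun.
have x2_ge0 (x : R) : 0 <= x ^+ 2 * psi x by rewrite mulr_ge0 ?sqr_ge0 ?expR_ge0.
have even (x : R) : psi (- x) = psi x by rewrite !normal_funE sqrrN.
have -> : (\int[lambda]_x (x ^+ 2 * normal_pdf (0 : R) 1 x)%:E =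
    \int[lambda]_x (normal_pdf (0 : R) 1 x)%:E)%E; last exact: integral_normal_pdf.
transitivity ((normal_peak 1)%:E * \int[lambda]_x (x ^+ 2 * psi x)%:E)%E.
  rewrite -ge0_integralZl//=; [|exact: mx2|by move=> x _; rewrite lee_fin x2_ge0].
  apply: eq_integral => x _; rewrite normal_pdfE ?oner_eq0// -EFinM.
  by congr EFin; rewrite mulrCA.
transitivity ((normal_peak 1)%:E * \int[lambda]_x (psi x)%:E)%E; last first.
  rewrite -ge0_integralZl//=; [|exact: mpsi|by move=> x _; rewrite lee_fin expR_ge0].
  by apply: eq_integral => x _; rewrite normal_pdfE ?oner_eq0.
congr (_ * _)%E.
rewrite (@ge0_symfun_integralT _ (fun x => x ^+ 2 * psi x))//; last 2 first.
  exact: continuous_sqrM_normal_fun.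
  by move=> x /=; rewrite even sqrrN.
rewrite (@ge0_symfun_integralT _ psi)//; last 3 first.
  by move=> x; exact: expR_ge0.
  exact: continuous_normal_fun.
  by move=> x /=; rewrite even.
by congr (_ * _)%E; rewrite -set_itvcy; exact: integral0y_sqr_normal_fun.
Qed.

(** Both the density and the Radon-Nikodym derivative integrate to
    [normal_prob] over every measurable set, so they agree almost everywhere. *)
Lemma ge0_integral_normal_prob (f : R -> R) :
  measurable_fun setT f -> (forall x, 0 <= f x) ->
  (\int[normal_prob 0 1]_x (f x)%:E =
   \int[lambda]_x (f x * normal_pdf 0 1 x)%:E)%E.
Proof.
move=> mf f0; have dom := @normal_prob_dominates R 0 1.
rewrite -(Radon_Nikodym_SigmaFinite.change_of_variables dom)//; last first.
  exact/measurable_EFinP.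
have mpdf : measurable_fun setT (fun x : R => (normal_pdf 0 1 x)%:E).
  by apply/measurable_EFinP; exact: measurable_normal_pdf.
under [RHS]eq_integral do rewrite EFinM.
apply: ae_eq_integral => //.
- apply: emeasurable_funM; first exact/measurable_EFinP.
  exact: measurable_int (Radon_Nikodym_SigmaFinite.f_integrable dom).
- by apply: emeasurable_funM => //; exact/measurable_EFinP.
- apply: ae_eqe_mul2l; apply: integral_ae_eq => //.
    exact: Radon_Nikodym_SigmaFinite.f_integrable.
  move=> E _ mE.
  by rewrite -Radon_Nikodym_SigmaFinite.f_integral.
Qed.

Lemma integral_sqr_normal_prob :
  (\int[@normal_prob R 0 1]_x (x ^+ 2)%:E = 1)%E.
Proof.
rewrite ge0_integral_normal_prob ?integral_sqr_normal_pdf//.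
by move=> x; rewrite sqr_ge0.
Qed.

Lemma normal_probN (A : set R) : measurable A ->
  normal_prob 0 1 [set x | A (- x)] = normal_prob 0 1 A.
Proof.
move=> mA; rewrite /normal_prob.
have m1 : measurable_fun setT (fun x : R => (normal_pdf 0 1 x)%:E).
  by apply/measurable_EFinP; exact: measurable_normal_pdf.
transitivity (\int[lambda]_(x in (-%R : _ -> measurableTypeR R) @^-1` A)
    (((fun x : R => (normal_pdf 0 1 x)%:E) \o -%R) x))%E.
  apply: eq_integral => x _ /=; congr EFin.
  by rewrite !normal_pdfE ?oner_eq0// !normal_funE sqrrN.
rewrite -ge0_integral_pushforward//=.
- by apply: eq_measure_integral => //= B mB _; exact: lebesgue_measureN.
- exact: measurable_funTS.
- by move=> x _; rewrite lee_fin normal_pdf_ge0.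
Qed.

End normal_second_moment.

(** * Image laws and square-integrable random vectors *)

Section law_transfer.
Context d1 d2 (T1 : measurableType d1) (T2 : measurableType d2) (R : realType).
Variables (P : {measure set T1 -> \bar R}) (mu : {measure set T2 -> \bar R}).
Variables (X : T1 -> T2).
Hypothesis mX : measurable_fun setT X.
Hypothesis lawX : forall A, measurable A -> mu A = P (X @^-1` A).
Local Open Scope ereal_scope.

Lemma ge0_integral_law (f : T2 -> \bar R) : measurable_fun setT f ->
  (forall x, 0 <= f x) -> \int[mu]_x f x = \int[P]_w f (X w).
Proof.
move=> mf f0; rewrite (eq_measure_integral (pushforward P X)); last first.
  by move=> A mA _; exact: lawX.
by rewrite ge0_integral_pushforward// preimage_setT.
Qed.

Lemma integral_law (f : T2 -> \bar R) : measurable_fun setT f ->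
  \int[mu]_x f x = \int[P]_w f (X w).
Proof.
move=> mf; rewrite integralE [RHS]integralE; congr (_ - _).
  rewrite ge0_integral_law//; last exact: measurable_funepos.
  apply: eq_integral => w _.
  by rewrite (funepos_comp f X : (fun w => f (X w))^\+ = _).
rewrite ge0_integral_law//; last exact: measurable_funeneg.
apply: eq_integral => w _.
by rewrite (funeneg_comp f X : (fun w => f (X w))^\- = _).
Qed.

Lemma integrable_law (f : T2 -> \bar R) : measurable_fun setT f ->
  mu.-integrable setT f <-> P.-integrable setT (f \o X).
Proof.
move=> mf; have mabs : measurable_fun setT (fun x => `|f x|).
  exact: measurableT_comp.
split=> /integrableP[_ foo]; apply/integrableP; split=> //.
- exact: measurableT_comp.
- by move: foo; rewrite ge0_integral_law.
- by rewrite ge0_integral_law.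
Qed.

End law_transfer.

Section square_integrable.
Context d (T : measurableType d) (R : realType) (P : {measure set T -> \bar R}).
Implicit Types (f g : T -> R).

Definition sqr_integrable f :=
  measurable_fun setT f /\ P.-integrable setT (fun w => (f w ^+ 2)%:E).

Lemma sqr_integrableM f g : sqr_integrable f -> sqr_integrable g ->
  P.-integrable setT (EFin \o (fun w => f w * g w)).
Proof.
move=> [mf f2] [mg g2]; apply: le_integrable (integrableD measurableT f2 g2) => //.
  by apply/measurable_EFinP; exact: measurable_funM.
move=> x _; rewrite /= lee_fin [leRHS]ger0_norm ?addr_ge0 ?sqr_ge0//.
rewrite normrM -(real_normK (num_real (f x))) -(real_normK (num_real (g x))).
by have := sqr_ge0 (`|f x| - `|g x|); nra.
Qed.

Lemma sqr_integrable0 : sqr_integrable (fun=> 0).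
Proof.
split; first exact: measurable_cst.
by rewrite expr0n/=; exact: integrable0.
Qed.

Lemma sqr_integrableD f g : sqr_integrable f -> sqr_integrable g ->
  sqr_integrable (fun w => f w + g w).
Proof.
move=> fL gL; have fg := sqr_integrableM fL gL.
have [mf f2] := fL; have [mg g2] := gL; split; first exact: measurable_funD.
have := integrableD measurableT (integrableD measurableT f2 g2)
  (integrableZl measurableT 2 fg).
apply: eq_integrable => // w _ /=.
by rewrite -EFinM -!EFinD; congr EFin; ring.
Qed.

Lemma sqr_integrableZ c f : sqr_integrable f -> sqr_integrable (fun w => c * f w).
Proof.
move=> [mf f2]; split; first exact: measurable_funM.
apply: eq_integrable (integrableZl measurableT (c ^+ 2) f2) => // w _ /=.
by rewrite -EFinM exprMn.
Qed.

Lemma sqr_integrable_sum (I : Type) (r : seq I) (F : I -> T -> R) :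
  (forall i, sqr_integrable (F i)) ->
  sqr_integrable (fun w => \sum_(i <- r) F i w).
Proof.
move=> FL; elim: r => [|i r IH].
  by under eq_fun do rewrite big_nil; exact: sqr_integrable0.
by under eq_fun do rewrite big_cons; exact: sqr_integrableD.
Qed.

Lemma Rintegral_sum (I : Type) (r : seq I) (F : I -> T -> R) :
  (forall i, P.-integrable setT (EFin \o F i)) ->
  (\int[P]_w (\sum_(i <- r) F i w) = \sum_(i <- r) \int[P]_w F i w)%R.
Proof.
move=> Fi; elim: r => [|i r IH].
  rewrite big_nil; under eq_Rintegral do rewrite big_nil.
  by rewrite /Rintegral integral0.
rewrite big_cons -IH -RintegralD//.
  by apply: eq_Rintegral => w _; rewrite big_cons.
apply: (eq_integrable _ (fun w => (\sum_(i <- r) (F i w)%:E)%E)) => //.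
  by move=> w _; rewrite /= sumEFin.
by apply: integrable_sum => // i0 _; exact: Fi.
Qed.

End square_integrable.

Section cV_measurability.
Context (R : realType).

Lemma measurable_coord n i : measurable_fun setT (fun x : 'cV[R]_n => x i 0).
Proof.
move=> _ A mA; apply: sub_sigma_algebra; rewrite setTI.
rewrite -bigcup_seq/=; exists i => /=; first by rewrite mem_index_enum.
by exists A => //; rewrite setTI.
Qed.

Lemma measurable_fun_cVP d (T : measurableType d) n (f : T -> 'cV[R]_n) :
  measurable_fun setT f <-> forall i, measurable_fun setT (fun w => f w i 0).
Proof.
split=> [mf i|mf]; first exact: (measurableT_comp (measurable_coord i) mf).
have sub : g_sigma_preimage (fun i w => f w i 0) `<=` measurable.
  apply: smallest_sub; first exact: sigma_algebra_measurable.
  rewrite -bigcup_seq/= => A [i _] [B mB <-]; exact: mf.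
move=> _ A mA; apply: sub.
have -> : g_sigma_preimage (fun i w => f w i 0) =
    g_sigma_preimage (fun i => (fun x : 'cV[R]_n => x i 0) \o f) by [].
rewrite (@g_sigma_preimage_comp _ _ _ _ (fun i (x : 'cV[R]_n) => x i 0)).
by exists A.
Qed.

Lemma measurable_mulmx m n (M : 'M[R]_(m, n)) :
  measurable_fun setT (mulmx M : 'cV[R]_n -> 'cV[R]_m).
Proof.
apply/measurable_fun_cVP => i.
under eq_fun do rewrite mxE.
apply: measurable_sum => j; apply: measurable_funM => //.
exact: measurable_coord.
Qed.

End cV_measurability.

Lemma sqr_integrable_integrable d (T : measurableType d) (R : realType)
    (P : probability T R) (f : T -> R) :
  sqr_integrable P f -> P.-integrable setT (EFin \o f).
Proof.
move=> [mf f2].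
have i1 : P.-integrable setT (EFin \o cst 1).
  exact: finite_measure_integrable_cst.
apply: le_integrable (integrableD measurableT f2 i1) => //.
  exact/measurable_EFinP.
move=> w _; rewrite /= lee_fin [leRHS]ger0_norm ?addr_ge0 ?sqr_ge0//.
by rewrite -(real_normK (num_real (f w))); have := sqr_ge0 (`|f w| - 1); nra.
Qed.

Section cross_correlation.
Context d (T : measurableType d) (R : realType) (P : probability T R).

Definition sqr_integrableV n (X : T -> 'cV[R]_n) :=
  forall i, sqr_integrable P (fun w => X w i 0).

Lemma cross_corrE n (X Y : T -> 'cV[R]_n) i j :
  cross_corr P X Y i j = \int[P]_w (X w i 0 * Y w j 0).
Proof.
rewrite mxE; apply: eq_Rintegral => w _.
by rewrite mxE big_ord1 !mxE.
Qed.

Lemma cross_corr_tr n (X Y : T -> 'cV[R]_n) :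
  (cross_corr P X Y)^T = cross_corr P Y X.
Proof.
apply/matrixP => i j; rewrite mxE !cross_corrE.
by apply: eq_Rintegral => w _; rewrite mulrC.
Qed.

Lemma sqr_integrableV_mulmx m n (A : 'M[R]_(m, n)) (X : T -> 'cV[R]_n) :
  sqr_integrableV X -> sqr_integrableV (fun w => A *m X w).
Proof.
move=> XL i; under eq_fun do rewrite mxE.
by apply: sqr_integrable_sum => k; exact: sqr_integrableZ.
Qed.

Lemma cross_corr_mulmx m n (A B : 'M[R]_(m, n)) (X Y : T -> 'cV[R]_n) :
  sqr_integrableV X -> sqr_integrableV Y ->
  cross_corr P (fun w => A *m X w) (fun w => B *m Y w) =
  A *m cross_corr P X Y *m B^T.
Proof.
move=> XL YL; apply/matrixP => i j; rewrite cross_corrE.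
have XY k l : P.-integrable setT (EFin \o (fun w => X w k 0 * Y w l 0)).
  exact: sqr_integrableM.
have cXY c k l : P.-integrable setT (EFin \o (fun w => c * (X w k 0 * Y w l 0))).
  exact: (integrableZl measurableT c (XY k l)).
transitivity (\int[P]_w (\sum_l \sum_k A i k * B j l * (X w k 0 * Y w l 0))).
  apply: eq_Rintegral => w _; rewrite !mxE mulr_sumr; apply: eq_bigr => l _.
  by rewrite mulr_suml; apply: eq_bigr => k _; ring.
rewrite Rintegral_sum; last first.
  move=> l; rewrite (_ : EFin \o _ =
    fun w => (\sum_k (A i k * B j l * (X w k 0 * Y w l 0))%:E)%E); last first.
    by apply/funext => w; rewrite /= sumEFin.
  by apply: integrable_sum => // k _; exact: cXY.
rewrite mxE; apply: eq_bigr => l _; rewrite !mxE mulr_suml.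
rewrite Rintegral_sum//; apply: eq_bigr => k _.
by rewrite RintegralZl// cross_corrE; ring.
Qed.

Lemma cross_corr_ae n (X Y X' Y' : T -> 'cV[R]_n) :
  measurable_fun setT X -> measurable_fun setT Y ->
  measurable_fun setT X' -> measurable_fun setT Y' ->
  {ae P, forall w, X w = X' w /\ Y w = Y' w} ->
  cross_corr P X Y = cross_corr P X' Y'.
Proof.
move=> /measurable_fun_cVP mX /measurable_fun_cVP mY.
move=> /measurable_fun_cVP mX' /measurable_fun_cVP mY' ae.
apply/matrixP => i j; rewrite !cross_corrE /Rintegral; congr fine.
apply: ae_eq_integral => //.
- by apply/measurable_EFinP; exact: measurable_funM.
- by apply/measurable_EFinP; exact: measurable_funM.
- by apply: filterS ae => w [-> ->].
Qed.

End cross_correlation.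

Section cross_correlation_law.
Context d1 d2 (T1 : measurableType d1) (T2 : measurableType d2) (R : realType).
Variables (P : probability T1 R) (mu : probability T2 R) (U : T1 -> T2).
Hypothesis mU : measurable_fun setT U.
Hypothesis lawU : forall A, measurable A -> mu A = P (U @^-1` A).

Lemma cross_corr_law n (X Y : T2 -> 'cV[R]_n) :
  measurable_fun setT X -> measurable_fun setT Y ->
  cross_corr mu X Y = cross_corr P (X \o U) (Y \o U).
Proof.
move=> /measurable_fun_cVP mX /measurable_fun_cVP mY.
apply/matrixP => i j; rewrite !cross_corrE /Rintegral; congr fine.
rewrite (integral_law mU lawU)//.
by apply/measurable_EFinP; exact: measurable_funM.
Qed.

Lemma sqr_integrable_law (f : T2 -> R) : measurable_fun setT f ->
  sqr_integrable mu f <-> sqr_integrable P (f \o U).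
Proof.
move=> mf; have m2 : measurable_fun setT (fun x => (f x ^+ 2)%:E).
  by apply/measurable_EFinP; exact: measurable_funX.
have [h1 h2] := integrable_law mU lawU m2.
by split=> -[_ f2]; split=> //; [exact: measurableT_comp|exact: h1|exact: h2].
Qed.

End cross_correlation_law.

(** * Gaussian vectors *)

Section gaussian_vectors.
Context (R : realType) (n : nat).
Implicit Types gamma : probability 'cV[R]_n R.

Definition cylinder (A : 'I_n -> set R) : set 'cV[R]_n :=
  [set z | forall i, A i (z i 0)].

Lemma measurable_cylinder A : (forall i, measurable (A i)) ->
  measurable (cylinder A).
Proof.
move=> mA; rewrite (_ : cylinder A =
  \bigcap_(i in [set: 'I_n]) ((fun z => z i 0) @^-1` A i)).
  apply: fin_bigcap_measurable => // i _.
  by rewrite -[X in measurable X]setTI; exact: measurable_coord.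
by apply/seteqP; split => [z Az i _|z Az i]; exact: Az.
Qed.

(** Cylinders are stable under intersection and generate the
    sigma-algebra. *)
Lemma cylinder_measure_unique (m1 : probability 'cV[R]_n R)
    (m2 : {measure set 'cV[R]_n -> \bar R}) :
  (forall A, (forall i, measurable (A i)) -> m1 (cylinder A) = m2 (cylinder A)) ->
  forall E, measurable E -> m1 E = m2 E.
Proof.
move=> m12 E mE.
pose G := [set C | exists2 A, (forall i, measurable (A i)) & C = cylinder A].
have GT : G setT.
  exists (fun=> setT) => //; by apply/seteqP; split.
apply: (g_sigma_algebra_measure_unique G _ (fun=> setT)) => //.
- by move=> _ [A mA ->]; exact: measurable_cylinder.
- by rewrite bigcup_const.
- move=> _ _ [A mA ->] [B mB ->]; exists (fun i => A i `&` B i).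
    by move=> i; exact: measurableI.
  apply/seteqP; split => z; first by move=> [Az Bz] i; split.
  by move=> AB; split => i; case: (AB i).
- by move=> _ [A mA ->]; exact: m12.
- by move=> _; rewrite (le_lt_trans (probability_le1 _ _)) ?ltry.
- move: E mE; apply: smallest_sub; first exact: smallest_sigma_algebra.
  rewrite -bigcup_seq/= => C [i _] [B mB <-]; apply: sub_sigma_algebra.
  exists (fun j => if j == i then B else setT).
    by move=> j; case: ifP.
  rewrite setTI; apply/seteqP; split=> [z Bz j|z /(_ i)]; last by rewrite eqxx.
  by case: ifPn => // /eqP ->.
Qed.

Lemma std_gaussian_unique gamma1 gamma2 :
  std_gaussian gamma1 -> std_gaussian gamma2 ->
  forall E, measurable E -> gamma1 E = gamma2 E.
Proof.
move=> s1 s2; apply: cylinder_measure_unique => A mA.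
by rewrite [LHS]s1// [RHS]s2.
Qed.

Variables (gamma : probability 'cV[R]_n R) (std : std_gaussian gamma).

Lemma std_gaussian_coord i (A : set R) : measurable A ->
  normal_prob 0 1 A = gamma ((fun z => z i 0) @^-1` A).
Proof.
move=> mA; pose A' (j : 'I_n) := if j == i then A else setT.
have mA' j : measurable (A' j) by rewrite /A'; case: ifP.
have <- : cylinder A' = (fun z => z i 0) @^-1` A.
  apply/seteqP; split=> [z /(_ i)|z Bz j]; rewrite /A' /=; first by rewrite eqxx.
  by case: ifPn => // /eqP ->.
rewrite [RHS](std mA') (bigD1 i)//= big1; last first.
  by move=> j /negbTE ji; rewrite /A' ji probability_setT.
by rewrite mulr1 /A' eqxx fineK ?fin_num_measure.
Qed.

Definition flip (i : 'I_n) : 'M[R]_n := diag_mx (\row_j (-1) ^+ (j == i)).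

Lemma flipE i (z : 'cV[R]_n) j : (flip i *m z) j 0 = (-1) ^+ (j == i) * z j 0.
Proof. by rewrite mul_diag_mx !mxE. Qed.

(** The normal density is even. This invariance yields the vanishing of the
    means and of the mixed second moments: both change sign under a flip. *)
Lemma std_gaussian_flip i (E : set 'cV[R]_n) : measurable E ->
  gamma E = gamma (mulmx (flip i) @^-1` E).
Proof.
move=> mE.
pose f : {mfun 'cV[R]_n >-> 'cV[R]_n} :=
  HB.pack (mulmx (flip i) : 'cV[R]_n -> 'cV[R]_n)
  (isMeasurableFun.Build _ _ _ _ _ (measurable_mulmx (flip i))).
apply: (@cylinder_measure_unique gamma (distribution gamma f)) => // A mA.
pose A' j := if j == i then [set x | A j (- x)] else A j.
have mA' j : measurable (A' j).
  rewrite /A'; case: ifP => // _.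
  have := (@oppr_measurable R setT) measurableT _ (mA j).
  by rewrite setTI.
have fA : f @^-1` cylinder A = cylinder A'.
  apply/seteqP; split=> z Az j; have := Az j; rewrite /A' /= flipE;
    by case: ifP; rewrite /= ?mulN1r ?mul1r.
transitivity (gamma (cylinder A')); last by rewrite -fA.
rewrite [LHS](std mA) [RHS](std mA'); congr EFin; apply: eq_bigr => j _.
by rewrite /A'; case: ifP => // _; rewrite normal_probN.
Qed.

Lemma integral_flip i (f : 'cV[R]_n -> \bar R) : measurable_fun setT f ->
  (\int[gamma]_z f z = \int[gamma]_z f (flip i *m z))%E.
Proof.
apply: integral_law; first exact: measurable_mulmx.
exact: std_gaussian_flip.
Qed.

Lemma std_gaussian_sqr i :
  (\int[gamma]_z (z i 0 ^+ 2)%:E = 1)%E.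
Proof.
rewrite -(@integral_sqr_normal_prob R).
apply/esym/(@integral_law _ _ _ _ _ gamma (@normal_prob R 0 1)
  (fun z : 'cV[R]_n => z i 0)).
- exact: measurable_coord.
- exact: std_gaussian_coord.
- by apply/measurable_EFinP; exact: measurable_funX.
Qed.

Lemma std_gaussian_sqr_integrable : sqr_integrableV gamma id.
Proof.
move=> i; have mi := @measurable_coord R n i; split=> //.
apply/integrableP; split; first by apply/measurable_EFinP; exact: measurable_funX.
under eq_integral do rewrite /= ger0_norm ?sqr_ge0//.
by rewrite std_gaussian_sqr ltry.
Qed.

Lemma Rintegral_flip_eq0 i (f : 'cV[R]_n -> R) : measurable_fun setT f ->
  (forall z, f (flip i *m z) = - f z) -> gamma.-integrable setT (EFin \o f) ->
  \int[gamma]_z f z = 0.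
Proof.
move=> mf fN fi; have /measurable_EFinP mEf := mf.
suff : \int[gamma]_z f z = - \int[gamma]_z f z by lra.
rewrite [LHS]/Rintegral (integral_flip i)//.
rewrite -mulN1r -RintegralZl// /Rintegral; congr fine.
apply: eq_integral => z _ /=.
by rewrite fN mulN1r.
Qed.

Lemma std_gaussian_cov : cross_corr gamma id id = 1%:M.
Proof.
apply/matrixP => i j; rewrite cross_corrE !mxE.
have [<-|ij] := eqVneq i j.
  rewrite /Rintegral; under eq_integral do rewrite -expr2.
  by rewrite std_gaussian_sqr.
apply: (@Rintegral_flip_eq0 i).
- by apply: measurable_funM; exact: measurable_coord.
- move=> z; rewrite !flipE eqxx eq_sym (negbTE ij).
  by rewrite mul1r mulN1r mulNr.
- by apply: sqr_integrableM; exact: std_gaussian_sqr_integrable.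
Qed.

End gaussian_vectors.

Section centered_gaussians.
Context (R : realType) (n : nat) (S : 'M[R]_n) (m : probability 'cV[R]_n R).
Hypotheses (Spd : pdmx S) (mS : centered_gaussian S m).

Lemma centered_gaussian_sqr_integrable : sqr_integrableV m id.
Proof.
have [gamma [std law]] := mS => i.
apply/(sqr_integrable_law (measurable_mulmx (sqrtmx S)) law (@measurable_coord R n i)).
exact: (sqr_integrableV_mulmx (sqrtmx S) (std_gaussian_sqr_integrable std)).
Qed.

Lemma centered_gaussian_cov : cross_corr m id id = S.
Proof.
have [gamma [std law]] := mS; have [[sS _] sqS _] := pdmx_sqrtmx Spd.
rewrite (cross_corr_law (measurable_mulmx (sqrtmx S)) law)//.
rewrite (@cross_corr_mulmx _ _ _ gamma _ _ (sqrtmx S) (sqrtmx S) id id).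
- by rewrite std_gaussian_cov// mulmx1 sS.
- exact: std_gaussian_sqr_integrable.
- exact: std_gaussian_sqr_integrable.
Qed.

Lemma centered_gaussian_integrable i : m.-integrable setT (fun x => (x i 0)%:E).
Proof. exact: sqr_integrable_integrable (centered_gaussian_sqr_integrable i). Qed.

Lemma centered_gaussian_mean i : \int[m]_x x i 0 = 0.
Proof.
have [gamma [std law]] := mS.
have mi := @measurable_coord R n i.
have gi k : gamma.-integrable setT (EFin \o (fun z : 'cV[R]_n => z k 0)).
  exact: sqr_integrable_integrable (std_gaussian_sqr_integrable std k).
rewrite /Rintegral (integral_law (measurable_mulmx (sqrtmx S)) law); last first.
  exact/measurable_EFinP.
rewrite -[LHS]/(\int[gamma]_z (sqrtmx S *m z) i 0).
under eq_Rintegral do rewrite mxE.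
rewrite Rintegral_sum; last by move=> k; exact: (integrableZl measurableT _ (gi k)).
rewrite big1// => k _; rewrite RintegralZl//.
rewrite (@Rintegral_flip_eq0 _ _ gamma std k _ (@measurable_coord R n k) _ (gi k))
  ?mulr0//.
by move=> z; rewrite flipE eqxx mulN1r.
Qed.

End centered_gaussians.

(** * Optimal transport by a symmetric linear map *)

Section quadratic_transport.
Context (R : realType) (n : nat).

Definition normsq (v : 'cV[R]_n) : R := \sum_i v i 0 ^+ 2.

Lemma normsq_ge0 v : 0 <= normsq v.
Proof. by apply: sumr_ge0 => i _; exact: sqr_ge0. Qed.

Lemma normsq_eq0 v : normsq v = 0 -> v = 0.
Proof.
move=> v0; apply/colP => i; rewrite mxE; apply/eqP; rewrite -sqrf_eq0; apply/eqP.
by apply: (psumr_eq0P _ v0) => // j _; exact: sqr_ge0.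
Qed.

Lemma measurable_normsq d (T : measurableType d) (U : T -> 'cV[R]_n) :
  measurable_fun setT U -> measurable_fun setT (fun w => normsq (U w)).
Proof.
move=> /measurable_fun_cVP mU; apply: measurable_sum => i.
exact: measurable_funX.
Qed.

Lemma integrable_normsq d (T : measurableType d) (P : probability T R)
  (U : T -> 'cV[R]_n) : sqr_integrableV P U ->
  P.-integrable setT (EFin \o (fun w => normsq (U w))).
Proof.
move=> UL.
rewrite (_ : EFin \o _ = fun w => (\sum_i (U w i 0 ^+ 2)%:E)%E).
  by apply: integrable_sum => // i _; case: (UL i).
by apply/funext => w; rewrite /= sumEFin.
Qed.

Variables (mu nu : probability 'cV[R]_n R) (H G : 'M[R]_n).
Hypotheses (muL : sqr_integrableV mu id) (nuL : sqr_integrableV nu id).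
Hypotheses (Hs : H^T = H) (HG : H *m G = 1%:M).
Let T := H *m H.
Hypothesis nuE : forall A, measurable A -> nu A = pushforward mu (mulmx T) A.

Let phi (x : 'cV[R]_n) := 2^-1 * (normsq x - normsq (H *m x)).
Let psi (y : 'cV[R]_n) := 2^-1 * (normsq y - normsq (G *m y)).
Let gap (z : 'cV[R]_n * 'cV[R]_n) := 2^-1 * normsq (H *m z.1 - G *m z.2).

(** The functions [phi] and [psi] are Kantorovich potentials, and [gap] is
    what is lost in the duality inequality. The cross term of [gap] is
    [x^T y] because [H *m G = 1]. *)
Lemma cost_split (z : 'cV[R]_n * 'cV[R]_n) :
  2^-1 * \sum_i (z.1 i 0 - z.2 i 0) ^+ 2 = phi z.1 + psi z.2 + gap z.
Proof.
case: z => x y /=.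
have -> : \sum_i (x i 0 - y i 0) ^+ 2 = normsq (x - y).
  by apply: eq_bigr => i _; rewrite !mxE.
have normsqB (u v : 'cV[R]_n) :
    normsq (u - v) = normsq u + normsq v - 2 * (u^T *m v) 0 0.
  rewrite /normsq [in RHS]mxE mulr_sumr -big_split -sumrB.
  apply: eq_bigr => i _.
  by rewrite !mxE /=; ring.
rewrite /phi /psi /gap /= !normsqB.
have -> : (H *m x)^T *m (G *m y) = x^T *m y.
  by rewrite trmx_mul Hs mulmxA -(mulmxA _ H) HG mulmx1.
by field.
Qed.

Section a_coupling.
Variable pi : probability ('cV[R]_n * 'cV[R]_n)%type R.
Hypothesis cpi : coupling mu nu pi.

Let law1 A : measurable A -> mu A = pi (fst @^-1` A).
Proof.
move=> mA; rewrite -(cpi.1 A mA); congr (pi _).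
by apply/seteqP; split=> [z []|z Az] //=.
Qed.

Let law2 A : measurable A -> nu A = pi (snd @^-1` A).
Proof.
move=> mA; rewrite -(cpi.2 A mA); congr (pi _).
by apply/seteqP; split=> [z []|z Az] //=.
Qed.

Let L1 : sqr_integrableV pi fst.
Proof.
by move=> i; apply/(sqr_integrable_law measurable_fst law1 (@measurable_coord R n i)).
Qed.

Let L2 : sqr_integrableV pi snd.
Proof.
by move=> i; apply/(sqr_integrable_law measurable_snd law2 (@measurable_coord R n i)).
Qed.

Let dualvalue := \int[mu]_x phi x + \int[nu]_y psi y.

Let mphi : measurable_fun setT phi.
Proof.
apply: measurable_funM => //; apply: measurable_funB.
  by apply: measurable_normsq; exact: measurable_id.
by apply: measurable_normsq; exact: measurable_mulmx.
Qed.

Let mpsi : measurable_fun setT psi.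
Proof.
apply: measurable_funM => //; apply: measurable_funB.
  by apply: measurable_normsq; exact: measurable_id.
by apply: measurable_normsq; exact: measurable_mulmx.
Qed.

Let gapL : sqr_integrableV pi (fun z => H *m z.1 - G *m z.2).
Proof.
move=> i; have := sqr_integrableD (sqr_integrableV_mulmx H L1 i)
  (sqr_integrableZ (-1) (sqr_integrableV_mulmx G L2 i)).
under [in X in X -> _]eq_fun do rewrite mulN1r.
by under [in X in _ -> X]eq_fun do rewrite mxE [in X in _ + X]mxE.
Qed.

Lemma integrable_gap : pi.-integrable setT (EFin \o gap).
Proof. exact: (integrableZl measurableT _ (integrable_normsq gapL)). Qed.

Lemma integrable_phi : mu.-integrable setT (EFin \o phi).
Proof.
have := integrableB measurableT (integrable_normsq muL)
  (integrable_normsq (sqr_integrableV_mulmx H muL)).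
by move=> /(integrableZl measurableT 2^-1).
Qed.

Lemma integrable_psi : nu.-integrable setT (EFin \o psi).
Proof.
have := integrableB measurableT (integrable_normsq nuL)
  (integrable_normsq (sqr_integrableV_mulmx G nuL)).
by move=> /(integrableZl measurableT 2^-1).
Qed.

Lemma transport_cost_split :
  transport_cost pi = (dualvalue%:E + \int[pi]_z (gap z)%:E)%E.
Proof.
have mEphi : measurable_fun setT (EFin \o phi) by exact/measurable_EFinP.
have mEpsi : measurable_fun setT (EFin \o psi) by exact/measurable_EFinP.
have iphi := (integrable_law measurable_fst law1 mEphi).1 integrable_phi.
have ipsi := (integrable_law measurable_snd law2 mEpsi).1 integrable_psi.
rewrite /transport_cost /dualvalue EFinD /Rintegral.
rewrite !fineK; last 2 first.
  exact: integrable_fin_num integrable_psi.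
  exact: integrable_fin_num integrable_phi.
rewrite (integral_law measurable_fst law1 mEphi).
rewrite (integral_law measurable_snd law2 mEpsi).
rewrite -integralD// -integralD//; last 2 first.
  exact: integrableD.
  exact: integrable_gap.
by apply: eq_integral => z _; rewrite cost_split.
Qed.

(** A nonnegative function of nonpositive integral vanishes almost
    everywhere, and [gap] vanishes exactly on the graph of [T]. *)
Lemma cross_corr_gap0 : (\int[pi]_z (gap z)%:E <= 0)%E ->
  cross_corr pi fst snd = cross_corr mu id id *m T.
Proof.
move=> gap0; have gge0 z : 0 <= gap z by rewrite mulr_ge0 ?invr_ge0// normsq_ge0.
have gapae : {ae pi, forall z, z.2 = T *m z.1}.
  have mgap : measurable_fun setT (EFin \o gap).
    by have /integrableP[] := integrable_gap.
  have : (\int[pi]_z `|(gap z)%:E| = 0)%E.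
    apply/eqP; rewrite eq_le; apply/andP; split.
      by under eq_integral do rewrite gee0_abs ?lee_fin//.
    by apply: integral_ge0 => z _; exact: abse_ge0.
  move/(ae_eq_integral_abs _ measurableT mgap); apply: filterS => z /(_ Logic.I).
  move=> /= [] /eqP; rewrite mulf_eq0 invr_eq0 pnatr_eq0/= => /eqP /normsq_eq0/eqP.
  rewrite subr_eq0 => /eqP zE.
  by rewrite /T -mulmxA zE mulmxA HG mul1mx.
rewrite (@cross_corr_ae _ _ _ pi _ fst snd fst (fun z => T *m z.1)) => //; last 2 first.
- apply: (measurableT_comp (measurable_mulmx T)) => //.
- by apply: filterS gapae => z ->.
have -> : cross_corr pi fst (fun z => T *m z.1) =
    cross_corr mu id (mulmx T).
  by rewrite (cross_corr_law measurable_fst law1)//; exact: measurable_mulmx.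
have -> : cross_corr mu id (mulmx T) =
    cross_corr mu (fun x => 1%:M *m x) (fun x => T *m x).
  by congr cross_corr; apply/funext => x; rewrite mul1mx.
rewrite (@cross_corr_mulmx _ _ _ mu _ _ 1%:M T id id)// mul1mx.
by rewrite /T trmx_mul Hs.
Qed.

End a_coupling.

(** The coupling carried by the graph of [T] has no duality gap. *)
Lemma is_OT_corr_linear_map : is_OT_corr mu nu (cross_corr mu id id *m T).
Proof.
pose f (x : 'cV[R]_n) := (x, T *m x).
have mf : measurable_fun setT f.
  by apply: measurable_fun_pair => //; exact: measurable_mulmx.
pose fM : {mfun 'cV[R]_n >-> ('cV[R]_n * 'cV[R]_n)%type} :=
  HB.pack f (isMeasurableFun.Build _ _ _ _ _ mf).
pose pi0 : probability ('cV[R]_n * 'cV[R]_n)%type R := distribution mu fM.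
have cpi0 : coupling mu nu pi0.
  split=> A mA; rewrite ?nuE// /pi0 /distribution /pushforward/=.
    by congr (mu _); apply/seteqP; split=> [z []|z Az] //=.
  by congr (mu _); apply/seteqP; split=> [z []|z Az] //=.
have gap0 : (\int[pi0]_z (gap z)%:E = 0)%E.
  have /integrableP[mgap _] := integrable_gap cpi0.
  rewrite (@integral_law _ _ _ _ _ mu pi0 f mf _ _ mgap)//.
  rewrite integral0_eq// => x _ /=.
  have GH : G *m H = 1%:M by exact: mulmx1C.
  rewrite /gap /f/= /T !mulmxA GH mul1mx subrr /normsq big1 ?mulr0// => i _.
  by rewrite mxE expr0n.
have gap_ge0 (pi : probability ('cV[R]_n * 'cV[R]_n)%type R) :
    (0 <= \int[pi]_z (gap z)%:E)%E.
  by apply: integral_ge0 => z _; rewrite lee_fin mulr_ge0 ?invr_ge0// normsq_ge0.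
split.
  exists pi0; split=> // pi cpi.
  by rewrite !transport_cost_split// gap0 leeD2l.
move=> pi [cpi opt]; apply: cross_corr_gap0 => //.
by have := opt _ cpi0; rewrite !transport_cost_split// gap0 leeD2lE.
Qed.

End quadratic_transport.

(** With [A = specmx P a] and [B = specmx P b], the map [T = H *m H] is
    [B^(1/2) A^(-1/2)]; commutation makes it symmetric,
    and it sends [A^(1/2) Z] to [B^(1/2) Z]. *)
Lemma gaussian_OT_corr (R : realType) n (P : 'M[R]_n) (a b : 'I_n -> R)
    (mu nu : probability 'cV[R]_n R) : P \in unitmx ->
  pdmx (specmx P a) -> pdmx (specmx P b) ->
  centered_gaussian (specmx P a) mu -> centered_gaussian (specmx P b) nu ->
  is_OT_corr mu nu (specmx P (fun i => Num.sqrt (a i * b i))).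
Proof.
move=> Pu apd bpd mua nub.
have a0 := pdmx_specmx_gt0 Pu apd; have b0 := pdmx_specmx_gt0 Pu bpd.
have [as_ _] := apd; have [bs _] := bpd.
pose h x y : R := Num.sqrt (Num.sqrt y / Num.sqrt x).
have h0 i : 0 < h (a i) (b i) by rewrite sqrtr_gt0 divr_gt0// sqrtr_gt0.
pose H := specmx P (fun i => h (a i) (b i)).
pose G := specmx P (fun i => (h (a i) (b i))^-1).
have HG : H *m G = 1%:M.
  rewrite specmxM// -(specmx1 Pu); apply: eq_specmx => i.
  by rewrite divff// gt_eqF.
have -> : specmx P (fun i => Num.sqrt (a i * b i)) =
    cross_corr mu id id *m (H *m H).
  rewrite (centered_gaussian_cov apd mua) !specmxM//; apply: eq_specmx => i.
  rewrite -expr2 sqr_sqrtr; last by rewrite divr_ge0// sqrtr_ge0.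
  rewrite sqrtrM ?ltW//.
  rewrite -{2}(sqr_sqrtr (ltW (a0 i))); field.
  by rewrite gt_eqF// sqrtr_gt0.
apply: (is_OT_corr_linear_map (G := G)) => //.
- exact: (centered_gaussian_sqr_integrable mua).
- exact: (centered_gaussian_sqr_integrable nub).
- exact: (@specmx_sym_fun _ _ _ Pu a b h).
have [gamma1 [std1 law1]] := mua; have [gamma2 [std2 law2]] := nub.
move=> A mA; have mHA : measurable (mulmx (H *m H) @^-1` A).
  by rewrite -[X in measurable X]setTI; exact: measurable_mulmx.
rewrite law2// /pushforward law1// /pushforward.
have mB : measurable (mulmx (sqrtmx (specmx P b)) @^-1` A).
  have := @measurable_mulmx R n n (sqrtmx (specmx P b)) measurableT A mA.
  by rewrite setTI.
rewrite (std_gaussian_unique std2 std1 mB).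
suff -> : sqrtmx (specmx P b) = H *m H *m sqrtmx (specmx P a).
  have -> : (mulmx (H *m H *m sqrtmx (specmx P a)) : 'cV[R]_n -> 'cV[R]_n) =
      mulmx (H *m H) \o mulmx (sqrtmx (specmx P a)).
    by apply/funext => z; exact/esym/mulmxA.
  by rewrite comp_preimage.
rewrite (@specmx_sqrt _ _ P a b (fun x _ => x))//; last by move=> i; exact: ltW.
rewrite (@specmx_sqrt _ _ P a b (fun _ y => y))//; last by move=> i; exact: ltW.
rewrite !specmxM//; apply: eq_specmx => i.
rewrite -expr2 sqr_sqrtr; last by rewrite divr_ge0// sqrtr_ge0.
by rewrite divfK// gt_eqF// sqrtr_gt0.
Qed.

(** * Linear differential equations *)

Section linear_ode.
Variables (R : realType) (N : nat) (A : R -> 'M[R]_N) (c : R).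
Hypotheses (c0 : 0 <= c) (Ac : forall t i j, 0 < t -> `|A t i j| <= c).

Definition solves m (Y : R -> 'M[R]_(m, N)) := mx_evolves Y (fun t => Y t *m A t).

Lemma solves_eq0 m (Y : R -> 'M[R]_(m, N)) : solves Y -> Y 0 = 0 ->
  forall t, 0 <= t -> Y t = 0.
Proof.
move=> sY Y0 t t0; apply/matrixP => i j; rewrite mxE.
apply: (vector_gronwall0 c0 (sY i)) t0 => [k|k s s0]; first by rewrite Y0 mxE.
rewrite mxE (le_trans (ler_norm_sum _ _ _))// mulr_sumr; apply: ler_sum => l _.
by rewrite normrM mulrC ler_wpM2r// Ac.
Qed.

Lemma solves_mull m p (B : 'M[R]_(p, m)) (Y : R -> 'M[R]_(m, N)) : solves Y ->
  solves (fun t => B *m Y t).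
Proof.
move=> sY; apply: eq_mx_evolves (mx_evolvesM (mx_evolves_cst B) sY) => // t _.
by rewrite mul0mx add0r mulmxA.
Qed.

Lemma solvesB m (Y Z : R -> 'M[R]_(m, N)) : solves Y -> solves Z ->
  solves (fun t => Y t - Z t).
Proof.
move=> sY sZ; apply: eq_mx_evolves (mx_evolvesB sY sZ) => // t _.
by rewrite mulmxBl.
Qed.

(** Finitely many members of the family, chosen with initial values of maximal
    rank, have initial values spanning those of all the others; uniqueness
    propagates the linear relations in time. Applied to the paths of a random
    process, this replaces domination arguments when differentiating
    expectations. *)
Lemma common_propagator (W : Type) (good : W -> Prop) (z : W -> R -> 'rV[R]_N) :
  (forall w, good w -> solves (z w)) ->
  exists2 Psi : R -> 'M[R]_N, solves Psi &
    forall w t, good w -> 0 <= t -> z w t = z w 0 *m Psi t.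
Proof.
move=> sz.
pose M k (w : 'I_k -> W) t : 'M[R]_(k, N) := \matrix_i z (w i) t.
pose attained r := `[< exists k (w : 'I_k -> W),
  (forall i, good (w i)) /\ \rank (M k w 0) = r >].
have ex_att : exists r, attained r.
  have w0 : 'I_0 -> W by case.
  by exists (\rank (M 0%N w0 0)); apply/asboolP; exists 0%N, w0; split=> [[]|].
have att_ub r : attained r -> (r <= N)%N.
  by move=> /asboolP[k [w [_ <-]]]; exact: rank_leq_col.
have [r /asboolP[k [w [gw rE]]] rmax] := ex_maxnP ex_att att_ub.
have span u : good u -> (z u 0 <= M k w 0)%MS.
  move=> gu.
  (* otherwise, appending [u] would increase the rank *)
  pose w' (i : 'I_(k + 1)) :=
    match fintype.split i with inl j => w j | inr _ => u end.
  have ME : M (k + 1)%N w' 0 = col_mx (M k w 0) (z u 0).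
    apply/row_matrixP => i; rewrite rowK /w' -{2}(@fintype.splitK k 1 i).
    by case: (fintype.split i) => j /=; [rewrite rowKu rowK|rewrite rowKd row_id].
  have /rmax : attained (\rank (M (k + 1)%N w' 0)).
    apply/asboolP; exists (k + 1)%N, w'; split=> // i.
    by rewrite /w'; case: (fintype.split i) => j.
  rewrite ME -rE -addsmxE => rk.
  have [] := mxrank_leqif_sup (addsmxSl (M k w 0) (z u 0)).
  move=> lerk eqrk; move: eqrk; rewrite eqn_leq lerk rk => /esym.
  by apply: submx_trans; exact: addsmxSr.
have sM : solves (M k w).
  move=> i j; apply: eq_evolves (sz _ (gw i) 0 j) => [t|t _]; first by rewrite mxE.
  by rewrite !mxE; apply: eq_bigr => l _; rewrite mxE.
exists (fun t => pinvmx (M k w 0) *m M k w t); first exact: solves_mull.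
move=> u t gu t0; apply/eqP; rewrite -subr_eq0; apply/eqP; move: t t0.
apply: solves_eq0.
  by apply: solvesB (sz _ gu) _; do 2 apply: solves_mull.
by rewrite mulmxA mulmxKpV ?subrr// span.
Qed.

End linear_ode.

(** * The matrix Riccati equation *)

Section entrywise_norm.
Context (R : realType).

Definition mxnorm1 m n (M : 'M[R]_(m, n)) := \sum_i \sum_j `|M i j|.

Lemma mxnorm1_ge0 m n (M : 'M[R]_(m, n)) : 0 <= mxnorm1 M.
Proof. by apply: sumr_ge0 => i _; apply: sumr_ge0. Qed.

Lemma mxnorm1_tr m n (M : 'M[R]_(m, n)) : mxnorm1 M^T = mxnorm1 M.
Proof.
rewrite /mxnorm1 exchange_big; apply: eq_bigr => i _; apply: eq_bigr => j _.
by rewrite mxE.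
Qed.

Lemma mxnorm1N m n (M : 'M[R]_(m, n)) : mxnorm1 (- M) = mxnorm1 M.
Proof. by apply: eq_bigr => i _; apply: eq_bigr => j _; rewrite mxE normrN. Qed.

Lemma mxnorm1D m n (M M' : 'M[R]_(m, n)) :
  mxnorm1 (M + M') <= mxnorm1 M + mxnorm1 M'.
Proof.
rewrite -big_split; apply: ler_sum => i _; rewrite -big_split; apply: ler_sum => j _.
by rewrite mxE ler_normD.
Qed.

Lemma mxnorm1M m n p (M : 'M[R]_(m, n)) (M' : 'M[R]_(n, p)) :
  mxnorm1 (M *m M') <= mxnorm1 M * mxnorm1 M'.
Proof.
rewrite /mxnorm1 mulr_suml; apply: ler_sum => i _.
apply: (@le_trans _ _ (\sum_j \sum_k `|M i k| * `|M' k j|)).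
  apply: ler_sum => j _; rewrite mxE (le_trans (ler_norm_sum _ _ _))//.
  by apply: ler_sum => k _; rewrite normrM.
rewrite exchange_big mulr_suml; apply: ler_sum => k _.
rewrite -mulr_sumr ler_wpM2l// (bigD1 k)//= lerDl.
by apply: sumr_ge0 => l _; apply: sumr_ge0.
Qed.

Lemma ler_mxnorm1 m n (M : 'M[R]_(m, n)) i j : `|M i j| <= mxnorm1 M.
Proof.
rewrite /mxnorm1 (bigD1 i)//= (bigD1 j)//= -addrA lerDl addr_ge0 ?sumr_ge0//.
by move=> k _; apply: sumr_ge0.
Qed.

Lemma mxnorm1_bounded m n c (M : 'M[R]_(m, n)) : (forall i j, `|M i j| <= c) ->
  mxnorm1 M <= c *+ (n * m).
Proof.
move=> Mc; rewrite mulrnA -[X in _ *+ X]card_ord -sumr_const; apply: ler_sum => i _.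
by rewrite -[X in _ *+ X]card_ord -sumr_const; apply: ler_sum.
Qed.

End entrywise_norm.

Section riccati.
Variables (R : realType) (n : nat) (A B : 'M[R]_n).

Definition riccati (J : 'M[R]_n) : 'M[R]_n :=
  A + B - J^T *m invmx A *m J - J *m invmx B *m J^T.

(** The vector field is quadratic, hence Lipschitz on bounded sets. *)
Lemma riccati_unique (J D : R -> 'M[R]_n) (c : R) : 0 <= c ->
  (forall t i j, 0 < t -> `|J t i j| <= c) ->
  (forall t i j, 0 < t -> `|D t i j| <= c) ->
  mx_evolves J (fun t => riccati (J t)) ->
  mx_evolves D (fun t => riccati (D t)) ->
  J 0 = D 0 -> forall t, 0 <= t -> J t = D t.
Proof.
move=> c0 Jc Dc eJ eD JD0 t t0.
apply/eqP; rewrite -subr_eq0; apply/eqP/matrixP => i j.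
rewrite [RHS]mxE; have eE := mx_evolvesB eJ eD.
pose b := c *+ (n * n); pose k := 2 * b * (mxnorm1 (invmx A) + mxnorm1 (invmx B)).
have b0 : 0 <= b by exact: mulrn_wge0.
have k0 : 0 <= k by rewrite !mulr_ge0 ?addr_ge0 ?mxnorm1_ge0.
apply: (@vector_gronwall0 R ('I_n * 'I_n)%type (fun p t => (J t - D t) p.1 p.2)
  (fun p t => (riccati (J t) - riccati (D t)) p.1 p.2) k k0 _ _ _ (i, j) t t0).
- by move=> p; exact: eE.
- by move=> p; rewrite JD0 subrr mxE.
move=> p s s0; apply: (le_trans (ler_mxnorm1 _ _ _)).
have -> : \sum_q `|(J s - D s) q.1 q.2| = mxnorm1 (J s - D s).
  by rewrite /mxnorm1 pair_bigA.
have Jb : mxnorm1 (J s) <= b by apply: mxnorm1_bounded => ? ?; exact: Jc.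
have Db : mxnorm1 (D s) <= b by apply: mxnorm1_bounded => ? ?; exact: Dc.
set E := J s - D s.
have -> : riccati (J s) - riccati (D s) =
    - (E^T *m invmx A *m J s + (D s)^T *m invmx A *m E)
    - (E *m invmx B *m (J s)^T + D s *m invmx B *m E^T).
  have JE : J s = D s + E by rewrite addrC subrK.
  have JTE : (J s)^T = (D s)^T + E^T.
    by rewrite JE; apply/matrixP => k1 k2; rewrite !mxE.
  rewrite /riccati JTE JE !mulmxDl !mulmxDr.
  apply/matrixP => i1 j1; rewrite !mxE; ring.
have bound3 (X Y Z : 'M[R]_n) x z : mxnorm1 X <= x -> mxnorm1 Z <= z ->
    mxnorm1 (X *m Y *m Z) <= x * mxnorm1 Y * z.
  move=> Xx Zz; apply: (le_trans (mxnorm1M _ _)).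
  apply: ler_pM; rewrite ?mxnorm1_ge0//; apply: (le_trans (mxnorm1M _ _)).
  by rewrite ler_wpM2r ?mxnorm1_ge0.
apply: (le_trans (mxnorm1D _ _)); rewrite !mxnorm1N.
apply: (le_trans (lerD (mxnorm1D _ _) (mxnorm1D _ _))).
have h1 := bound3 E^T (invmx A) (J s) (mxnorm1 E) b.
have h2 := bound3 (D s)^T (invmx A) E b (mxnorm1 E).
have h3 := bound3 E (invmx B) (J s)^T (mxnorm1 E) b.
have h4 := bound3 (D s) (invmx B) E^T b (mxnorm1 E).
rewrite !mxnorm1_tr in h1 h2 h3 h4.
have {}h1 := h1 (lexx _) Jb; have {}h2 := h2 Db (lexx _).
have {}h3 := h3 (lexx _) Jb; have {}h4 := h4 Db (lexx _).
apply: (le_trans (lerD (lerD h1 h2) (lerD h3 h4))).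
by rewrite /k le_eqVlt; apply/orP; left; apply/eqP; ring.
Qed.

End riccati.

Section commuting_riccati.
Variables (R : realType) (n : nat) (P : 'M[R]_n) (a b : 'I_n -> R).
Hypotheses (Pu : P \in unitmx).
Hypotheses (apd : pdmx (specmx P a)) (bpd : pdmx (specmx P b)).

Let rate i := (a i + b i) / Num.sqrt (a i * b i).

Definition commuting_solution (t : R) : 'M[R]_n :=
  specmx P (fun i => Num.sqrt (a i * b i) * tanhM (rate i) t).

Let a0 := pdmx_specmx_gt0 Pu apd.
Let b0 := pdmx_specmx_gt0 Pu bpd.

Lemma commuting_solution0 : commuting_solution 0 = 0.
Proof.
apply/matrixP => i j; rewrite specmx_entry mxE big1// => k _.
by rewrite tanhM0 !mulr0 mul0r.
Qed.

Lemma commuting_solution_bounded :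
  exists2 c, 0 <= c & forall t i j, `|commuting_solution t i j| <= c.
Proof.
pose F : 'M[R]_n := \matrix_(i, j)
  \sum_k `|invmx P i k| * Num.sqrt (a k * b k) * `|P k j|.
exists (mxnorm1 F) => [|t i j]; first exact: mxnorm1_ge0.
apply: le_trans (ler_mxnorm1 F i j); apply: le_trans (ler_norm _).
rewrite specmx_entry mxE (le_trans (ler_norm_sum _ _ _))//.
apply: ler_sum => k _; rewrite !normrM ler_wpM2r// ler_wpM2l//.
rewrite ger0_norm ?sqrtr_ge0// -[leRHS]mulr1 ler_wpM2l ?sqrtr_ge0//.
exact: tanhM_bound.
Qed.

Lemma commuting_solution_cvg i j :
  commuting_solution t i j @[t --> +oo] -->
  specmx P (fun i => Num.sqrt (a i * b i)) i j.
Proof.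
rewrite specmx_entry.
have -> : (fun t => commuting_solution t i j) = fun t =>
    \sum_k invmx P i k * (Num.sqrt (a k * b k) * tanhM (rate k) t) * P k j.
  by apply/funext => t; rewrite specmx_entry.
apply: cvg_big => [|k _]; first exact: add_continuous.
apply: cvgM; last exact: cvg_cst.
apply: cvgM; first exact: cvg_cst.
rewrite -[X in _ --> X]mulr1; apply: cvgM; first exact: cvg_cst.
apply: tanhM_cvg; rewrite divr_gt0 ?addr_gt0// sqrtr_gt0 mulr_gt0//.
Qed.

(** On each joint eigenspace the equation reads
    [d' = a + b - d^2 / a - d^2 / b = (a + b) (1 - d^2 / (a b))]. *)
Lemma commuting_solution_riccati :
  mx_evolves commuting_solution
    (fun t => riccati (specmx P a) (specmx P b) (commuting_solution t)).
Proof.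
move=> i j.
have ds t : (commuting_solution t)^T = commuting_solution t.
  have [as_ _] := apd; have [bs _] := bpd.
  exact: (@specmx_sym_fun _ _ _ Pu a b (fun x y =>
    Num.sqrt (x * y) * tanhM ((x + y) / Num.sqrt (x * y)) t)).
have s0 k : 0 < Num.sqrt (a k * b k) by rewrite sqrtr_gt0 mulr_gt0.
have := evolves_sum (index_enum 'I_n) (fun k =>
  evolvesZ (invmx P i k * Num.sqrt (a k * b k) * P k j) (tanhM_evolves (rate k))).
apply: eq_evolves => [t|t _].
  by rewrite specmx_entry; apply: eq_bigr => k _; ring.
rewrite /riccati ds !specmxV//; try by move=> k; rewrite gt_eqF.
rewrite /commuting_solution !specmxM// specmxD !specmxB specmx_entry.
apply: eq_bigr => k _.
set s := Num.sqrt _.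
have sE : s ^+ 2 = a k * b k by rewrite sqr_sqrtr// ltW// mulr_gt0.
have tE : a k + b k = (rate k) * s by rewrite /rate divfK// gt_eqF.
set t' := tanhM _ _.
transitivity (invmx P i k * (a k + b k - (a k + b k) * t' ^+ 2) * P k j).
  by rewrite tE; ring.
have -> : s * t' * (a k)^-1 * (s * t') = b k * t' ^+ 2.
  transitivity (s ^+ 2 * t' ^+ 2 / a k); first by ring.
  by rewrite sE; field; rewrite gt_eqF.
have -> : s * t' * (b k)^-1 * (s * t') = a k * t' ^+ 2.
  transitivity (s ^+ 2 * t' ^+ 2 / b k); first by ring.
  by rewrite sE; field; rewrite gt_eqF.
by ring.
Qed.

End commuting_riccati.

(** * The dynamics of the cross-correlation *)

Section gaussian_dynamics.
Context (R : realType) (n : nat) (Smu Snu : 'M[R]_n).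
Context (mu nu : probability 'cV[R]_n R) (d : measure_display).
Context (Omega : measurableType d) (P : probability Omega R).
Variables (X Y : R -> {RV P >-> 'cV[R]_n}) (EYX EXY : R -> Omega -> 'cV[R]_n).
Hypotheses (Smu_pd : pdmx Smu) (Snu_pd : pdmx Snu).
Hypotheses (mu_gauss : centered_gaussian Smu mu).
Hypotheses (nu_gauss : centered_gaussian Snu nu).
Hypothesis dyn : L2_OCD X Y EYX EXY.
Hypothesis init : independent_start mu nu X Y.
Hypothesis joint_gauss : gaussian_joint_laws mu nu X Y.
Hypothesis versions : gaussian_versions Smu Snu X Y EYX EXY.

Let J t := cross_corr P (X t) (Y t).

Let mX t : measurable_fun setT (X t). Proof. exact: measurable_funPT. Qed.
Let mY t : measurable_fun setT (Y t). Proof. exact: measurable_funPT. Qed.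

Let lawX t : 0 <= t -> forall A, measurable A -> mu A = P (X t @^-1` A).
Proof. by move=> /joint_gauss[_ lX _] A mA; rewrite -lX. Qed.

Let lawY t : 0 <= t -> forall A, measurable A -> nu A = P (Y t @^-1` A).
Proof. by move=> /joint_gauss[_ _ lY] A mA; rewrite -lY. Qed.

Lemma sqr_integrable_X t : 0 <= t -> sqr_integrableV P (X t).
Proof.
move=> t0 i; apply/(sqr_integrable_law (mX t) (lawX t0) (@measurable_coord R n i)).
exact: (centered_gaussian_sqr_integrable mu_gauss).
Qed.

Lemma sqr_integrable_Y t : 0 <= t -> sqr_integrableV P (Y t).
Proof.
move=> t0 i; apply/(sqr_integrable_law (mY t) (lawY t0) (@measurable_coord R n i)).
exact: (centered_gaussian_sqr_integrable nu_gauss).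
Qed.

Lemma cov_X t : 0 <= t -> cross_corr P (X t) (X t) = Smu.
Proof.
move=> t0; rewrite -(centered_gaussian_cov Smu_pd mu_gauss).
by rewrite (cross_corr_law (mX t) (lawX t0)).
Qed.

Lemma cov_Y t : 0 <= t -> cross_corr P (Y t) (Y t) = Snu.
Proof.
move=> t0; rewrite -(centered_gaussian_cov Snu_pd nu_gauss).
by rewrite (cross_corr_law (mY t) (lawY t0)).
Qed.

(** The law at time [0] is a product of centered laws, so Fubini's theorem
    applies. *)
Lemma cross_corr_start : J 0 = 0.
Proof.
apply/matrixP => i j; rewrite /J cross_corrE mxE.
have mXY : measurable_fun setT (fun w => (X 0 w, Y 0 w)).
  exact: measurable_fun_pair.
have mi : measurable_fun setT (fun z : 'cV[R]_n * 'cV[R]_n => z.1 i 0).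
  exact: (measurableT_comp (@measurable_coord R n i) measurable_fst).
have mj : measurable_fun setT (fun z : 'cV[R]_n * 'cV[R]_n => z.2 j 0).
  exact: (measurableT_comp (@measurable_coord R n j) measurable_snd).
pose f (z : 'cV[R]_n * 'cV[R]_n) : \bar R := (z.1 i 0 * z.2 j 0)%:E.
have mf : measurable_fun setT f by apply/measurable_EFinP; exact: measurable_funM.
have law A : measurable A ->
    (mu \x nu)%E A = P ((fun w => (X 0 w, Y 0 w)) @^-1` A).
  by move=> mA; rewrite -init.
have fi : (mu \x nu)%E.-integrable setT f.
  apply/(integrable_law mXY law mf).
  exact: (sqr_integrableM (sqr_integrable_X (lexx 0) i)
    (sqr_integrable_Y (lexx 0) j)).
rewrite /Rintegral.
have -> : (\int[P]_w (X 0 w i 0 * Y 0 w j 0)%:E = \int[(mu \x nu)%E]_z f z)%E.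
  by rewrite (integral_law mXY law mf).
rewrite -(integral12_prod_meas1 fi) integral0_eq// => x _.
rewrite /fubini_F /f/=; under eq_integral do rewrite EFinM.
rewrite integralZl//; last exact: (centered_gaussian_integrable nu_gauss).
have := centered_gaussian_mean nu_gauss j; rewrite /Rintegral => mean0.
rewrite -[X in (_ * X)%E]fineK ?mean0 ?mule0//.
by apply: integrable_fin_num => //; exact: (centered_gaussian_integrable nu_gauss).
Qed.

Lemma cross_corr_bounded : exists2 c, 0 <= c &
  forall t i j, 0 <= t -> `|J t i j| <= c.
Proof.
exists (mxnorm1 Smu + mxnorm1 Snu) => [|t i j t0].
  by rewrite addr_ge0 ?mxnorm1_ge0.
have XL := sqr_integrable_X t0; have YL := sqr_integrable_Y t0.
rewrite /J cross_corrE.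
apply: (@le_trans _ _
    (\int[P]_w (X t w i 0 * X t w i 0 + Y t w j 0 * Y t w j 0))).
  apply: (le_trans (le_normr_Rintegral _ (sqr_integrableM (XL i) (YL j)))) => //.
  apply: le_Rintegral => //.
  - have := sqr_integrableM (XL i) (YL j) => /integrable_abse.
    by apply: eq_integrable.
  - exact: (integrableD measurableT (sqr_integrableM (XL i) (XL i))
      (sqr_integrableM (YL j) (YL j))).
  move=> w _; rewrite normrM.
  rewrite -(real_normK (num_real (X t w i 0)) : _ = X t w i 0 * X t w i 0).
  rewrite -(real_normK (num_real (Y t w j 0)) : _ = Y t w j 0 * Y t w j 0).
  by have := sqr_ge0 (`|X t w i 0| - `|Y t w j 0|); nra.
rewrite RintegralD//; [|exact: sqr_integrableM..].
rewrite -!cross_corrE cov_X// cov_Y//.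
by apply: lerD; apply: (le_trans (ler_norm _)); exact: ler_mxnorm1.
Qed.

Let Z t (w : Omega) : 'cV[R]_(n + n) := col_mx (X t w) (Y t w).

Let mZ t : measurable_fun setT (Z t).
Proof.
apply/measurable_fun_cVP => i; rewrite -(@fintype.splitK n n i).
have /measurable_fun_cVP mXi := mX t; have /measurable_fun_cVP mYi := mY t.
case: (fintype.split i) => k /=.
  by under eq_fun do rewrite col_mxEu; exact: mXi.
by under eq_fun do rewrite col_mxEd; exact: mYi.
Qed.

Let sqr_integrable_Z t : 0 <= t -> sqr_integrableV P (Z t).
Proof.
move=> t0 i; rewrite -(@fintype.splitK n n i).
case: (fintype.split i) => k /=.
  by under eq_fun do rewrite col_mxEu; exact: sqr_integrable_X.
by under eq_fun do rewrite col_mxEd; exact: sqr_integrable_Y.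
Qed.

Let K t := cross_corr P (Z t) (Z t).

Let KE t : 0 <= t -> K t = block_mx Smu (J t) (J t)^T Snu.
Proof.
move=> t0; rewrite -(cov_X t0) -(cov_Y t0) /J cross_corr_tr -[LHS]submxK.
congr block_mx; apply/matrixP => i j;
  rewrite [LHS]mxE [LHS]mxE /K !cross_corrE;
  by apply: eq_Rintegral => w _; rewrite /Z ?col_mxEu ?col_mxEd.
Qed.

(** Generator of the linear equation satisfied by the rows
    [(X_t^T, Y_t^T)] of a path. *)
Let A t : 'M[R]_(n + n) :=
  block_mx (- (invmx Smu *m J t)) 1%:M 1%:M (- (invmx Snu *m (J t)^T)).

Let A_bounded : exists2 c, 0 <= c & forall t i j, 0 < t -> `|A t i j| <= c.
Proof.
have [c c0 Jc] := cross_corr_bounded; pose b := c *+ (n * n).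
have b0 : 0 <= b by exact: mulrn_wge0.
have Jb t : 0 < t -> mxnorm1 (J t) <= b.
  by move=> t0; apply: mxnorm1_bounded => i j; apply: Jc; exact: ltW.
pose k := mxnorm1 (invmx Smu) * b + mxnorm1 (invmx Snu) * b.
have k1 : 0 <= mxnorm1 (invmx Smu) * b by rewrite mulr_ge0 ?mxnorm1_ge0.
have k2 : 0 <= mxnorm1 (invmx Snu) * b by rewrite mulr_ge0 ?mxnorm1_ge0.
have id1 (i j : 'I_n) : `|(1%:M : 'M[R]_n) i j| <= 1 + k.
  rewrite mxE; case: (i == j); rewrite ?normr1 ?normr0 ?lerDl addr_ge0//.
  by rewrite addr_ge0.
exists (1 + k) => [|t i j t0]; first by rewrite !addr_ge0.
have bound (S M : 'M[R]_n) i' j' : mxnorm1 M <= b -> mxnorm1 S * b <= k ->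
    `|(- (S *m M)) i' j'| <= 1 + k.
  move=> Mb Sk; rewrite mxE normrN (le_trans (ler_mxnorm1 _ _ _))//.
  rewrite (le_trans (mxnorm1M _ _))// (@le_trans _ _ k) ?lerDr//.
  by apply: le_trans Sk; rewrite ler_wpM2l ?mxnorm1_ge0.
rewrite -(@fintype.splitK n n i) -(@fintype.splitK n n j) /A.
case: (fintype.split i) (fintype.split j) => i' [] j' /=.
- by rewrite block_mxEul bound ?Jb// lerDl.
- by rewrite block_mxEur.
- by rewrite block_mxEdl.
- by rewrite block_mxEdr bound ?mxnorm1_tr ?Jb// lerDr.
Qed.

Let good (w : Omega) := forall t, 0 <= t ->
  is_derive_ge0 (fun s => X s w) t (Y t w - (J t)^T *m invmx Smu *m X t w) /\
  is_derive_ge0 (fun s => Y s w) t (X t w - J t *m invmx Snu *m Y t w).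

Let ae_good : {ae P, forall w, good w}.
Proof.
have [_ _ deriv] := dyn; apply: filterS2 deriv versions => w dw vw t t0.
by have [<- <-] := vw t t0; exact: dw.
Qed.

Let good_solves w : good w -> solves A (fun t => (Z t w)^T).
Proof.
move=> gw.
have eX := mx_evolves_tr (is_derive_ge0_evolves (fun t t0 => (gw t t0).1)).
have eY := mx_evolves_tr (is_derive_ge0_evolves (fun t t0 => (gw t t0).2)).
have Smu_sym := pdmx_invmx_sym Smu_pd.
have Snu_sym := pdmx_invmx_sym Snu_pd.
have rhsE t : (Z t w)^T *m A t = row_mx
    (Y t w - (J t)^T *m invmx Smu *m X t w)^T
    (X t w - J t *m invmx Snu *m Y t w)^T.
  rewrite /Z tr_col_mx /A mul_row_block !linearB/= !trmx_mul Smu_sym Snu_sym trmxK.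
  by rewrite !mulmx1 !mulmxN !mulmxA addrC.
move=> i j; rewrite -(@fintype.splitK n n j).
case: (fintype.split j) => k /=.
  apply: eq_evolves (eX i k) => [t|t _]; first by rewrite /Z tr_col_mx row_mxEl.
  by rewrite rhsE row_mxEl.
apply: eq_evolves (eY i k) => [t|t _]; first by rewrite /Z tr_col_mx row_mxEr.
by rewrite rhsE row_mxEr.
Qed.

(** By [common_propagator], [Z t = (Psi t)^T *m Z 0] almost surely, so the
    matrix of second moments [K' t = (Psi t)^T *m K 0 *m Psi t] has derivative
    [A^T *m K' + K' *m A]. Its diagonal blocks are constantly [Smu] and [Snu],
    and the upper right block of this derivative is the Riccati vector
    field. *)
Lemma cross_corr_riccati : exists J' : R -> 'M[R]_n,
  (forall t, 0 <= t -> J t = J' t) /\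
  mx_evolves J' (fun t => riccati Smu Snu (J' t)).
Proof.
have [c c0 Ac] := A_bounded.
have [Psi sPsi ZPsi] := common_propagator c0 Ac good_solves.
pose K' t := (Psi t)^T *m K 0 *m Psi t.
have KK' t : 0 <= t -> K t = K' t.
  move=> t0; rewrite /K.
  rewrite (@cross_corr_ae _ _ _ P _ _ _ (fun w => (Psi t)^T *m Z 0 w)
    (fun w => (Psi t)^T *m Z 0 w)) => //.
  - by rewrite cross_corr_mulmx ?trmxK//; exact: sqr_integrable_Z.
  - exact: (measurableT_comp (measurable_mulmx _)).
  - exact: (measurableT_comp (measurable_mulmx _)).
  - apply: filterS ae_good => w gw.
    suff -> : Z t w = (Psi t)^T *m Z 0 w by [].
    by apply: trmx_inj; rewrite trmx_mul trmxK; exact: ZPsi.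
have eK' : mx_evolves K' (fun t => (A t)^T *m K' t + K' t *m A t).
  apply: eq_mx_evolves (mx_evolvesM
    (mx_evolvesM (mx_evolves_tr sPsi) (mx_evolves_cst (K 0))) sPsi) => // t _.
  by rewrite mulmx0 addr0 trmx_mul /K' !mulmxA.
pose J' t := ursubmx (K' t).
have JJ' t : 0 <= t -> J t = J' t.
  by move=> t0; rewrite /J' -KK'// KE// block_mxKur.
exists J'; split=> // i j.
apply: eq_evolves (eK' (lshift n i) (rshift n j)) => [t|t t0].
  by rewrite !mxE.
have t0' := ltW t0.
have Smu_sym := pdmx_invmx_sym Smu_pd.
rewrite -KK'// KE// /A tr_block_mx !mulmx_block add_block_mx block_mxEur.
rewrite -JJ'// /riccati; congr (fun_of_matrix _ i j).
rewrite linearN/= trmx_mul Smu_sym trmx1 mul1mx mulmx1 mulmxN mulNmx.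
rewrite -mulmxA [in RHS]mulmxA.
apply/matrixP => k l; rewrite !mulmxA !mxE; ring.
Qed.

End gaussian_dynamics.

Theorem proposition4p1 (R : realType) (n : nat)
    (Smu Snu : 'M[R]_n) (mu nu : probability 'cV[R]_n R)
    (d : measure_display) (Omega : measurableType d)
    (P : probability Omega R)
    (X Y : R -> {RV P >-> 'cV[R]_n}) (EYX EXY : R -> Omega -> 'cV[R]_n)
    (Smu_pd : pdmx Smu) (Snu_pd : pdmx Snu)
    (mu_gauss : centered_gaussian Smu mu)
    (nu_gauss : centered_gaussian Snu nu)
    (dyn : L2_OCD X Y EYX EXY)
    (init : independent_start mu nu X Y)
    (joint_gauss : gaussian_joint_laws mu nu X Y)
    (versions : gaussian_versions Smu Snu X Y EYX EXY)
    (comm : Smu *m Snu - Snu *m Smu = 0) :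
  let Jinf := sqrtmx Smu *m sqrtmx (sqrtmx Smu *m Snu *m sqrtmx Smu)
                *m invmx (sqrtmx Smu) in
  cross_corr P (X t) (Y t) @[t --> +oo] --> Jinf /\
  is_OT_corr mu nu Jinf.
Proof.
move=> Jinf; rewrite {}/Jinf.
have comm' : Smu *m Snu = Snu *m Smu by apply/eqP; rewrite -subr_eq0 comm.
have [Smu_sym _] := Smu_pd; have [Snu_sym _] := Snu_pd.
have [Q [a [b [Qu SmuE SnuE]]]] :=
  commuting_symmetric_specmx Smu_sym Snu_sym comm'.
subst Smu Snu; rewrite commuting_sqrtmx_formula//; split; last first.
  exact: gaussian_OT_corr.
have [J [XYJ eJ]] := cross_corr_riccati Smu_pd Snu_pd mu_gauss nu_gauss dyn
  joint_gauss versions.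
have [c c0 Jc] := cross_corr_bounded Smu_pd Snu_pd mu_gauss nu_gauss joint_gauss.
have [c' c'0 Dc] := commuting_solution_bounded Q a b.
have JD t : 0 <= t -> J t = commuting_solution Q a b t.
  apply: (@riccati_unique _ _ (specmx Q a) (specmx Q b) J
    (commuting_solution Q a b) (c + c')) => //.
  - by rewrite addr_ge0.
  - by move=> s i j /ltW s0; rewrite -XYJ// (le_trans (Jc s i j s0))// lerDl.
  - by move=> s i j s0; rewrite (le_trans (Dc _ _ _))// lerDr.
  - exact: commuting_solution_riccati.
  - rewrite commuting_solution0 -XYJ//.
    exact: (cross_corr_start mu_gauss nu_gauss init joint_gauss).
move=> A [B nB sBA].
have nearB (ij : 'I_n * 'I_n) : \forall t \near +oo,
    B ij.1 ij.2 (commuting_solution Q a b t ij.1 ij.2).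
  exact: (commuting_solution_cvg Qu Smu_pd Snu_pd) (nB ij.1 ij.2).
have t0 : \forall t \near +oo, (0 : R) <= t.
  by apply: nbhs_pinfty_ge; rewrite num_real.
apply: filterS2 t0 (filter_forall _ nearB) => t t0 Bt.
apply: sBA => i j; rewrite XYJ// JD//; exact: (Bt (i, j)).
Qed.
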